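(* Let $N\ge1$ and $p>1$. Then there exists $\gamma=\gamma(N,p)>0$ such that, if $\mu\in\mathcal M$ satisfies $$\int_0^T s^{-\frac{N(p-1)}2}\left(\sup_{z\in\overline\Omega}\int_{B_\Omega(z,\sqrt s)}\frac{d\mu(y)}{y_N+\sqrt s}\right)^{p-1}ds\le\gamma$$ for some $T>0$, then problem (P) possesses a solution in $Q_T$.
   Context: $\Omega:=\mathbb R^{N-1}\times(0,\infty)$ if $N\ge2$ and $\Omega:=(0,\infty)$ if $N=1$; points are written $x=(x',x_N)$. $B(x,r)$ is the open ball in $\mathbb R^N$ and $B_\Omega(x,r):=B(x,r)\cap\overline\Omega$. $Q_T:=\Omega\times(0,T)$. $\mathcal M$ is the set of nonnegative Radon measures on $\overline\Omega$. $\mathcal L(Q_T)$ is the set of nonnegative, measurable, almost everywhere finite functions on $Q_T$. Kernels: $\Gamma_d(x,t):=(4\pi t)^{-d/2}\exp(-|x|^2/(4t))$ on $\mathbb R^d\times(0,\infty)$. The Dirichlet heat kernel of $\Omega$ is $$G(x,y,t):=\Gamma_N(x-y,t)\left(1-\exp\left(-\frac{x_Ny_N}{t}\right)\right),\qquad x,y\in\overline\Omega,\ t>0,$$ and, for $x,y\in\overline\Omega$, $t>0$, $K(x,y,t):=y_N^{-1}G(x,y,t)$ if $y_N>0$ and $K(x,y,t):=(\partial_{y_N}G)(x,y,t)=\frac{x_N}{t}\Gamma_N(x-y,t)$ if $y_N=0$. Problem (P) is $\partial_tu=\Delta u+u^p$ in $\Omega$, $t>0$, with $u=0$ on $\partial\Omega$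 and $x_Nu(x,0)=\mu$ on $\overline\Omega$. A function $u\in\mathcal L(Q_T)$ is a solution to (P) in $Q_T$ if $$u(x,t)=\int_{\overline\Omega}K(x,y,t)\,d\mu(y)+\int_0^t\int_\Omega G(x,y,t-s)u(y,s)^p\,dy\,ds$$ for almost all $(x,t)\in Q_T$. *)

(* Defs.v *)
From HB Require Import structures.
From mathcomp Require Import all_boot all_order all_algebra.
From mathcomp Require Import all_classical all_reals all_analysis.
From mathcomp Require Import measurable_realfun ring.
Set Implicit Arguments.
Unset Strict Implicit.
Unset Printing Implicit Defensive.
Import Order.TTheory GRing.Theory Num.Theory.
Import numFieldNormedType.Exports.
Local Open Scope classical_set_scope.
Local Open Scope ring_scope.

(* MathComp-Analysis puts no sigma-algebra on row vectors.  As it does for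
   tuples, we take the one generated by the coordinates; R being second
   countable, it is the Borel sigma-algebra of 'rV[R]_n. *)
Section measurable_rV.
Context {R : realType} (n : nat).

Let coord : 'I_n -> 'rV[R]_n -> R := fun i x => x 0 i.

Let rV_set0 : g_sigma_preimage coord set0.
Proof. exact: sigma_algebra0. Qed.

Let rV_setC A : g_sigma_preimage coord A -> g_sigma_preimage coord (~` A).
Proof. exact: sigma_algebraC. Qed.

Let rV_bigcup (F : (set 'rV[R]_n)^nat) :
  (forall i, g_sigma_preimage coord (F i)) ->
  g_sigma_preimage coord (\bigcup_i (F i)).
Proof. exact: sigma_algebra_bigcup. Qed.

HB.instance Definition _ := @isMeasurable.Build default_measure_display
  'rV[R]_n (g_sigma_preimage coord) rV_set0 rV_setC rV_bigcup.

End measurable_rV.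

Lemma measurable_rV_coord (R : realType) n (i : 'I_n) :
  measurable_fun [set: 'rV[R]_n] (fun x : 'rV[R]_n => x 0 i).
Proof.
move=> _ Y mY; rewrite setTI; apply: sub_sigma_algebra => /=.
rewrite -bigcup_seq/=; exists i => /=; first by rewrite mem_index_enum.
by exists Y => //; rewrite setTI.
Qed.

Lemma measurable_fun_rVP (R : realType) d (T : measurableType d) n
    (f : T -> 'rV[R]_n) :
  (forall i, measurable_fun [set: T] (fun t => f t 0 i)) ->
  measurable_fun [set: T] f.
Proof.
move=> mf; suff : preimage_set_system [set: T] f measurable `<=` measurable.
  by move=> + _ A mA; apply; exists A.
rewrite -[X in X `<=` _](@g_sigma_preimage_comp _ _ n _
  (fun i (x : 'rV[R]_n) => x 0 i)).
apply: smallest_sub; first exact: sigma_algebra_measurable.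
case: n => [|n] in f mf *; first by rewrite big_ord0.
rewrite -bigcup_mkord_ord; apply: bigcup_sub => i Ii.
by move=> A [B mB <-]; exact: mf.
Qed.

Definition cons_rV (R : realType) n (z : 'rV[R]_n * measurableTypeR R) :
  'rV[R]_n.+1 :=
  \row_i (if unlift ord0 i is Some j then z.1 0 j else z.2).

Lemma measurable_cons_rV (R : realType) n :
  measurable_fun setT (@cons_rV R n).
Proof.
apply: measurable_fun_rVP => i; rewrite /cons_rV.
case: (unliftP ord0 i) => [j ->|->].
  rewrite (_ : (fun _ => _) = (fun x : 'rV[R]_n => x 0 j) \o fst).
    by apply: measurableT_comp => //; exact: measurable_rV_coord.
  by apply/funext => z; rewrite mxE liftK.
rewrite (_ : (fun _ => _) = snd); first exact: measurable_snd.
by apply/funext => z; rewrite mxE unlift_none.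
Qed.

HB.instance Definition _ (R : realType) n :=
  isMeasurableFun.Build _ _ _ _ (@cons_rV R n) (@measurable_cons_rV R n).

Section lebesgue_rVS.
Context {R : realType} (n : nat) (mu : {measure set 'rV[R]_n -> \bar R}).

Definition lebesgue_rVS : set 'rV[R]_n.+1 -> \bar R :=
  pushforward (mu \x @lebesgue_measure R)%E (@cons_rV R n).

Let lebesgue_rVS0 : lebesgue_rVS set0 = 0%E.
Proof. exact: measure0. Qed.

Let lebesgue_rVS_ge0 A : (0 <= lebesgue_rVS A)%E.
Proof. exact: measure_ge0. Qed.

Let lebesgue_rVS_sigma_additive : semi_sigma_additive lebesgue_rVS.
Proof. exact: measure_semi_sigma_additive. Qed.

HB.instance Definition _ := isMeasure.Build _ _ _ lebesgue_rVS
  lebesgue_rVS0 lebesgue_rVS_ge0 lebesgue_rVS_sigma_additive.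

End lebesgue_rVS.

Fixpoint lebesgue_rV (R : realType) n : {measure set 'rV[R]_n -> \bar R} :=
  if n is m.+1 return {measure set 'rV[R]_n -> \bar R} then
    lebesgue_rVS (lebesgue_rV R m)
  else dirac (0 : 'rV[R]_0).

Lemma lebesgue_rV_box (R : realType) n (A : 'I_n -> set (measurableTypeR R)) :
  (forall i, measurable (A i)) ->
  lebesgue_rV R n [set x | forall i, A i (x 0 i)] =
  (\prod_(i < n) lebesgue_measure (A i))%E.
Proof.
elim: n A => [|n ih] A mA.
  rewrite big_ord0 /= diracE mem_set//.
  by case.
rewrite big_ord_recl /= /lebesgue_rVS /pushforward.
rewrite (_ : _ @^-1` _ =
    [set x : 'rV[R]_n | forall i, A (lift ord0 i) (x 0 i)] `*` A ord0).
  rewrite product_measure1E//.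
    by rewrite muleC; congr (_ * _)%E; exact: (ih (fun i => A (lift ord0 i))).
  rewrite (_ : [set _ | _] =
      \bigcap_(i in [set: 'I_n]) (fun x : 'rV[R]_n => x 0 i) @^-1`
        A (lift ord0 i)).
    apply: fin_bigcap_measurable => [|i _]; first exact: finite_finset.
    by rewrite -[X in measurable X]setTI; exact: measurable_rV_coord (mA _).
  by apply/seteqP; split=> x /= h i; [move=> _; exact: h|exact: h].
apply/seteqP; split=> -[x a] /=.
  move=> h; split=> [i|]; last by have := h ord0; rewrite mxE unlift_none.
  by have := h (lift ord0 i); rewrite mxE liftK.
move=> -[h0 h1] i; rewrite mxE /=.
by case: (unliftP ord0 i) => [j ->|->].
Qed.

(* R^N as R^(N-1) x R, so that x = (x', x_N) has x.1 = x' and x.2 = x_N; to be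
   used for 0 < N only.  measurableTypeR R is R, with the sigma-algebra on which
   MathComp-Analysis defines the Lebesgue measure. *)
Notation eucl R N := ('rV[R]_N.-1 * measurableTypeR R)%type.

Section half_space.
Context {R : realType} (N : nat).
Local Notation E := (eucl R N).

Definition lebesgueE : {measure set E -> \bar R} :=
  (lebesgue_rV R N.-1 \x @lebesgue_measure R)%E.

Definition sqnorm (x : E) : R := \sum_i x.1 0 i ^+ 2 + x.2 ^+ 2.

Definition Omega : set E := [set x | 0 < (x.2 : R)].

Definition Omegabar : set E := [set x | 0 <= (x.2 : R)].

Definition BOmega (x : E) (r : R) : set E :=
  [set y | Num.sqrt (sqnorm (y - x)) < r] `&` Omegabar.

Definition QT (T : R) : set (E * measurableTypeR R) := Omega `*` `]0, T[.

Definition Gamma (x : E) (t : R) : R :=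
  (4 * pi * t) `^ (- (N%:R / 2)) * expR (- (sqnorm x / (4 * t))).

Definition G (x y : E) (t : R) : R :=
  Gamma (x - y) t * (1 - expR (- (x.2 * y.2 / t))).

(* The second case is the derivative of G in y_N at y_N = 0, see
   is_derive_G_boundary. *)
Definition K (x y : E) (t : R) : R :=
  if 0 < (y.2 : R) then y.2^-1 * G x y t else x.2 / t * Gamma (x - y) t.

Lemma is_derive_G_boundary (x y : E) (t : R) : 0 < t -> y.2 = 0 :> R ->
  is_derive (0 : R) (1 : R) (fun r : R => G x (y.1, r) t) (K x y t).
Proof.
move=> t0 y0; rewrite /K y0 ltxx.
pose c := \sum_i (x.1 0 i - y.1 0 i) ^+ 2; pose x2 : R := x.2.
have sqnormE r : sqnorm (x - (y.1, r) : E) = c + (x2 - r) ^+ 2.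
  by rewrite /sqnorm; congr (_ + _); apply: eq_bigr => i _; rewrite !mxE.
pose a : R := (4 * pi * t) `^ (- (N%:R / 2)).
have -> : x - y = (x - (y.1, 0 : R)) :> E.
  by rewrite -y0; case: (y).
rewrite /G /Gamma /= sqnormE.
rewrite (_ : (fun r => _) =
    (a *: (expR \o ((- (4 * t)^-1) *: (cst c + (cst x2 - id) ^+ 2)))) *
    (cst 1 - (expR \o ((- (x2 / t)) *: id)))); last first.
  apply/funext => r; rewrite sqnormE !fctE /= /GRing.scale /=.
  by congr (_ * expR _ * (1 - expR _)); rewrite -/x2; ring.
apply: is_derive_eq.
rewrite !fctE /= /GRing.scale /= !mulr0 expR0 !subrr !(mul0r, mulr0).
by rewrite -/a -/x2 mulNr (mulrC (4 * t)^-1); ring.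
Qed.

Lemma closure_Omega : closure (Omega : set ('rV[R]_N.-1 * R)) = Omegabar.
Proof.
rewrite eqEsubset; split=> [|x x0 B].
  have cO : closed (Omegabar : set ('rV[R]_N.-1 * R)).
    apply: (@preimage_closed _ _ (snd : 'rV[R]_N.-1 * R -> R) [set a | 0 <= a]).
      by move=> z _; exact: cvg_snd.
    exact: closed_ge.
  rewrite [X in _ `<=` X](closure_id _).1//; apply: closureS => x /=.
  exact: ltW.
move=> -[[P Q] /= [xP /nbhs_ballP[e /= e0 eQ]] PQ].
exists (x.1, (x.2 : R) + e / 2); split => /=.
  by rewrite /Omega /=; apply: ltr_wpDl => //; rewrite divr_gt0.
apply: PQ; split => /=; first exact: nbhs_singleton.
apply: eQ; rewrite /ball /= opprD addNKr normrN gtr0_norm ?divr_gt0//.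
by rewrite ltr_pdivrMr// ltr_pMr// ltr1n.
Qed.

(* A measure on the closed half-space is seen as a measure on R^N carried by it.
   A Borel measure on R^N that is finite on compact sets is regular, so
   regularity need not be required. *)
Definition radon (mu : {measure set E -> \bar R}) : Prop :=
  mu (~` Omegabar) = 0%E /\
  forall A : set ('rV[R]_N.-1 * R), compact A -> (mu A < +oo)%E.

(* The class L(Q_T): functions valued in [0, +oo], almost everywhere finite. *)
Definition inL (T : R) (u : E * measurableTypeR R -> \bar R) : Prop :=
  [/\ measurable_fun (QT T) u,
      forall z, QT T z -> (0 <= u z)%E &
      {ae (lebesgueE \x @lebesgue_measure R)%E,
        forall z, QT T z -> (u z < +oo)%E}].

Local Open Scope ereal_scope.

Definition is_solution (p : R) (mu : {measure set E -> \bar R}) (T : R)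
    (u : E * measurableTypeR R -> \bar R) : Prop :=
  inL T u /\
  {ae lebesgueE \x @lebesgue_measure R, forall z, QT T z ->
    u z = \int[mu]_(y in Omegabar) (K z.1 y z.2)%:E +
      \int[@lebesgue_measure R]_(s in `]0%R, (z.2 : R)[)
        \int[lebesgueE]_(y in Omega) ((G z.1 y (z.2 - s))%:E * u (y, s) `^ p)}.

End half_space.

Arguments lebesgueE : clear implicits.
Arguments sqnorm {R} N x.
Arguments Omega {R} N.
Arguments Omegabar {R} N.
Arguments BOmega {R} N x r.
Arguments QT {R} N T.
Arguments Gamma {R} N x t.
Arguments G {R} N x y t.
Arguments K {R} N x y t.
Arguments radon {R} N mu.
Arguments inL {R} N T u.
Arguments is_solution {R} N p mu T u.

(* Main.v *)
Require Import Defs.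
From HB Require Import structures.
From mathcomp Require Import all_boot all_order all_algebra.
From mathcomp Require Import all_classical all_reals all_analysis.
From mathcomp Require Import measurable_realfun ring lra.
Import Order.TTheory GRing.Theory Num.Theory.
Import numFieldNormedType.Exports.
Local Open Scope classical_set_scope.
Local Open Scope ring_scope.
Local Open Scope ereal_scope.

Set Implicit Arguments.
Unset Strict Implicit.
Unset Printing Implicit Defensive.

(** The free evolution of the initial datum is
    U(x,t) = \int K(x,y,t) dmu(y) ([potential]), and twice U is a supersolution
    of the integral equation as soon as \int_0^T |U(s)|_oo^(p-1) ds is small:
    writing U^p <= |U(s)|_oo^(p-1) U and using that the Dirichlet heat
    semigroup carries U(s) below U(t) ([potential_semigroup_le]), the Duhamel
    term of 2U is at most 2^p (\int_0^t |U(s)|_oo^(p-1) ds) U(t)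
    ([duhamel_free_term_le]).  The Picard iterates started from 0 then increase
    and stay below 2U, and their limit solves the equation
    ([monotone_iteration]).

    The hypothesis bounds \int_0^T |U(s)|_oo^(p-1) ds up to a constant, because
    |U(s)|_oo <= C s^(-N/2) M(s), where M(s) ([local_mass]) is the supremum over
    z of the integral of 1/(y_N + sqrt s) over the ball of radius sqrt s centred
    at z ([potential_le]).  Pointwise,
    K(x,y,t) <= C Gamma(x-y,2t) / (y_N + sqrt t) ([K_le]): far from the boundary
    the factor 1/y_N is comparable to 1/(y_N + sqrt t), near it the reflected
    Gaussian contributes x_N/t, and half of the Gaussian decay absorbs
    x_N/sqrt t.  To pass from the Gaussian weight to balls, Gamma(x-y,2t) is
    compared with the average of z |-> Gamma(x-z,4t) over the ball of radius
    sqrt t around y ([Gamma_average_le]); exchanging the integrals in y and z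
    leaves the masses of the balls around z, weighted by a Gaussian of total
    mass 1.

    The semigroup inequality comes from the factorization of G into a product of
    Gaussians in the tangential variables and the odd reflection of a Gaussian
    in the normal one ([GE]), for which Chapman-Kolmogorov is completion of
    squares; for K at a boundary point it follows from Fatou's lemma, K being
    there the limit of G(x,(z',h),t)/h as h tends to 0. *)

(** * Integrals of nonnegative functions and Lebesgue measure on row vectors *)

(** The integral of a nonnegative function is the supremum of the integrals of
    the simple functions below it, whence monotonicity. It applies when the
    larger function involves a supremum over uncountably many balls. *)
Lemma ge0_le_integral_nonmeasurable d (T : measurableType d) (R : realType)
    (mu : {measure set T -> \bar R}) (D : set T) (f1 f2 : T -> \bar R) :
  (forall x, D x -> 0 <= f1 x) -> (forall x, D x -> f1 x <= f2 x) ->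
  \int[mu]_(x in D) f1 x <= \int[mu]_(x in D) f2 x.
Proof.
move=> f10 f12; have f20 x : D x -> 0 <= f2 x.
  by move=> Dx; exact: le_trans (f10 _ Dx) (f12 _ Dx).
rewrite !ge0_integralE//; apply: ge_ereal_sup => _ [h hf <-].
apply: ereal_sup_ubound; exists h => // x /=.
exact: le_trans (hf x) (lee_restrict f12 x).
Qed.

Lemma ge0_subset_integral_nonmeasurable d (T : measurableType d) (R : realType)
    (mu : {measure set T -> \bar R}) (A B : set T) (f : T -> \bar R) :
  A `<=` B -> (forall x, B x -> 0 <= f x) ->
  \int[mu]_(x in A) f x <= \int[mu]_(x in B) f x.
Proof.
move=> AB f0; rewrite integral_mkcond [leRHS]integral_mkcond.
apply: ge0_le_integral_nonmeasurable => x _.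
  by apply: erestrict_ge0 => {}x /AB; exact: f0.
rewrite /patch; have [xA|xA] := boolP (x \in A).
  by rewrite mem_set//; apply: AB; rewrite inE in xA.
by case: ifP => //; rewrite inE => /f0.
Qed.

Lemma ge0_integral_le_scale_nonmeasurable d (T : measurableType d)
    (R : realType) (mu : {measure set T -> \bar R}) (D : set T)
    (f g : T -> \bar R) (c : R) :
  measurable D -> measurable_fun D f ->
  (forall x, D x -> 0 <= f x) -> (0 <= c)%R ->
  (forall x, D x -> f x <= c%:E * g x) ->
  \int[mu]_(x in D) f x <= c%:E * \int[mu]_(x in D) g x.
Proof.
move=> mD mf f0; rewrite le_eqVlt => /predU1P[<-|c0] fg.
  rewrite mul0e integral0_eq// => x Dx.
  by apply/eqP; rewrite eq_le f0// (le_trans (fg _ Dx))// mul0e.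
have ci0 : (0 <= c^-1)%R by rewrite invr_ge0 ltW.
rewrite [leLHS](_ : _ = \int[mu]_(x in D) (c%:E * (c^-1%:E * f x))); last first.
  by apply: eq_integral => x _; rewrite muleA -EFinM divff ?gt_eqF// mul1e.
rewrite ge0_integralZl_EFin//; last 3 first.
- by move=> x Dx; rewrite mule_ge0 ?f0// lee_fin.
- exact: measurable_funeM.
- exact: ltW.
rewrite lee_pmul2l// ?lte_fin//.
apply: ge0_le_integral_nonmeasurable => x Dx.
  by rewrite mule_ge0 ?f0// lee_fin.
by rewrite lee_pdivrMl// fg.
Qed.

(** Tonelli's theorem takes sigma-finiteness from the structure of the
    measure; the copy turns a proof of it into such a structure on the same
    function. *)
Section sigma_finite_copy.
Context d (T : measurableType d) (R : realType).
Variables (mu : {measure set T -> \bar R}) (h : sigma_finite setT mu).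

Definition sigma_finite_copy of sigma_finite setT mu : set T -> \bar R := mu.

HB.instance Definition _ := Measure.on (sigma_finite_copy h).

HB.instance Definition _ :=
  Measure_isSigmaFinite.Build _ _ _ (sigma_finite_copy h) h.

End sigma_finite_copy.

Section tonelli.
Context d1 d2 (T1 : measurableType d1) (T2 : measurableType d2) (R : realType).
Variables (m1 : {measure set T1 -> \bar R}) (m2 : {measure set T2 -> \bar R}).
Hypotheses (s1 : sigma_finite setT m1) (s2 : sigma_finite setT m2).

Lemma tonelli_swap (f : T1 * T2 -> \bar R) :
  measurable_fun setT f -> (forall z, 0 <= f z) ->
  \int[m1]_x \int[m2]_y f (x, y) = \int[m2]_y \int[m1]_x f (x, y).
Proof.
exact: (@fubini_tonelli d1 d2 T1 T2 R
  (sigma_finite_copy s1) (sigma_finite_copy s2)).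
Qed.

Lemma tonelli_measurable (f : T1 * T2 -> \bar R) :
  measurable_fun setT f -> (forall z, 0 <= f z) ->
  measurable_fun setT (fun x => \int[m2]_y f (x, y)).
Proof.
exact: (@measurable_fun_fubini_tonelli_F d1 d2 T1 T2 R (sigma_finite_copy s2)).
Qed.

Lemma tonelli_measurable_snd (f : T1 * T2 -> \bar R) :
  measurable_fun setT f -> (forall z, 0 <= f z) ->
  measurable_fun setT (fun y => \int[m1]_x f (x, y)).
Proof.
exact: (@measurable_fun_fubini_tonelli_G d1 d2 T1 T2 R (sigma_finite_copy s1)).
Qed.

Lemma tonelli_prod (f : T1 * T2 -> \bar R) :
  measurable_fun setT f -> (forall z, 0 <= f z) ->
  \int[m1 \x m2]_z f z = \int[m2]_y \int[m1]_x f (x, y).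
Proof.
exact: (@fubini_tonelli2 d1 d2 T1 T2 R
  (sigma_finite_copy s1) (sigma_finite_copy s2)).
Qed.

Lemma sigma_finite_prod : sigma_finite setT (m1 \x m2).
Proof.
pose c2 : {sigma_finite_measure set T2 -> \bar R} := sigma_finite_copy s2.
have /sigma_finiteP[F [TF ndF Foo]] := s1.
have /sigma_finiteP[G [TG ndG Goo]] := s2.
exists (fun n => F n `*` G n).
  rewrite -setXTT TF TG; apply/seteqP; split=> -[x y] /=.
    move=> [[k _ Fkx] [l _ Gly]]; exists (maxn k l) => //; split => /=.
      exact: (subsetPset _ _ (ndF _ _ (leq_maxl k l))) Fkx.
    exact: (subsetPset _ _ (ndG _ _ (leq_maxr k l))) Gly.
  by move=> [k _ [Fkx Gky]]; split; exists k.
move=> k; have [mF Fk] := Foo k; have [mG Gk] := Goo k.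
split; first exact: measurableX.
rewrite (@product_measure1E _ _ _ _ _ m1 c2)//.
by rewrite lte_mul_pinfty// ge0_fin_numE.
Qed.

Lemma integral_prod_mul (f : T1 -> \bar R) (g : T2 -> \bar R) :
  measurable_fun setT f -> measurable_fun setT g ->
  (forall x, 0 <= f x) -> (forall y, 0 <= g y) ->
  \int[m1 \x m2]_z (f z.1 * g z.2) = \int[m1]_x f x * \int[m2]_y g y.
Proof.
move=> mf mg f0 g0; rewrite tonelli_prod /=; last 2 first.
- apply: emeasurable_funM; apply: measurableT_comp => //.
- by move=> z; rewrite mule_ge0.
under eq_integral do rewrite ge0_integralZr//.
by rewrite ge0_integralZl// integral_ge0.
Qed.

End tonelli.

Section lebesgue_rV_theory.
Context {R : realType}.

Lemma sigma_finite_lebesgue : sigma_finite setT (@lebesgue_measure R).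
Proof. exact: sigma_finiteT. Qed.

Lemma measurable_rV_forall n (A : 'I_n -> set (measurableTypeR R)) :
  (forall i, measurable (A i)) ->
  measurable [set x : 'rV[R]_n | forall i, A i (x 0%R i)].
Proof.
move=> mA; rewrite (_ : [set _ | _] =
    \bigcap_(i in [set: 'I_n]) (fun x : 'rV[R]_n => x 0%R i) @^-1` A i).
  apply: fin_bigcap_measurable => [|i _]; first exact: finite_finset.
  by rewrite -[X in measurable X]setTI; exact: measurable_rV_coord (mA _).
by apply/seteqP; split=> x /= h i; [move=> _; exact: h|exact: h].
Qed.

Lemma sigma_finite_lebesgue_rV n : sigma_finite setT (lebesgue_rV R n).
Proof.
pose I (k : nat) : set R := `[(- k%:R)%R, k%:R%R]%classic.
exists (fun k => [set x : 'rV[R]_n | forall i, I k (x 0%R i)]).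
  apply/esym; rewrite -subTset => x _.
  (* The sum of the absolute values dominates each coordinate. *)
  exists (Num.truncn (\sum_i `|x 0%R i|)%R).+1 => // i /=.
  rewrite /I /= in_itv /= -ler_norml.
  apply: (@le_trans _ _ (\sum_i `|x 0%R i|)%R); last exact/ltW/truncnS_gt.
  rewrite (bigD1 i)//= lerDl.
  by apply: sumr_ge0.
move=> k; split.
  by apply: (@measurable_rV_forall n (fun=> I k)) => i; exact: measurable_itv.
rewrite (@lebesgue_rV_box R n (fun=> I k))//.
rewrite ltey_eq; apply/orP; left.
apply: (big_ind (fun x : \bar R => x \is a fin_num)) => //.
  exact: fin_numM.
  by move=> i _; rewrite lebesgue_measure_itv /=; case: ifP.
by move=> _; exact: measurable_itv.
Qed.

Lemma sigma_finite_lebesgueE N : sigma_finite setT (lebesgueE R N).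
Proof.
exact: sigma_finite_prod (sigma_finite_lebesgue_rV _) sigma_finite_lebesgue.
Qed.

Lemma measurable_prod_coord n (f : 'I_n -> R -> R) :
  (forall i, measurable_fun setT (f i : measurableTypeR R -> R)) ->
  measurable_fun setT (fun x : 'rV[R]_n => \prod_i f i (x 0%R i))%R.
Proof.
move=> mf; apply: measurable_prod => i _.
exact: measurableT_comp (mf i) (measurable_rV_coord _).
Qed.

(** Tonelli, one coordinate at a time: the measure in dimension n.+1 is the
    image of a product with the line. *)
Lemma integral_rV_prod n (f : 'I_n -> R -> R) :
  (forall i, measurable_fun setT (f i : measurableTypeR R -> R)) ->
  (forall i a, 0 <= f i a)%R ->
  \int[lebesgue_rV R n]_x (\prod_i f i (x 0%R i))%:E =
  \prod_i \int[@lebesgue_measure R]_a (f i a)%:E.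
Proof.
elim: n f => [|n ih] f mf f0.
  rewrite big_ord0 integral_dirac//; last first.
    by apply/measurable_EFinP; exact: measurable_prod_coord.
  by rewrite diracT mul1e big_ord0.
rewrite big_ord_recl /= /lebesgue_rVS ge0_integral_pushforward//; last 2 first.
- by apply/measurable_EFinP; exact: measurable_prod_coord.
- by move=> x _ /=; rewrite lee_fin; apply: prodr_ge0.
rewrite preimage_setT muleC -ih//.
rewrite -(integral_prod_mul (sigma_finite_lebesgue_rV n) sigma_finite_lebesgue);
  last 4 first.
- apply/measurable_EFinP.
  exact: (@measurable_prod_coord _ (fun i => f (lift ord0 i))).
- by apply/measurable_EFinP; exact: mf.
- by move=> x; rewrite lee_fin; apply: prodr_ge0.
- by move=> x; rewrite lee_fin.
apply: eq_integral => -[x a] _ /=; rewrite -EFinM; congr EFin.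
rewrite big_ord_recl mulrC /cons_rV; congr (_ * _)%R.
  by apply: eq_bigr => i _; rewrite mxE liftK.
by rewrite mxE unlift_none.
Qed.

End lebesgue_rV_theory.

(** * Measurability of the heat kernels *)

Section kernel_measurability.
Context {R : realType}.
Local Open Scope ring_scope.

Lemma measurable_fun_powR d (T : measurableType d) (f : T -> R) p :
  measurable_fun setT f -> measurable_fun setT (fun x => f x `^ p).
Proof. exact: (measurableT_comp (measurable_powR p)). Qed.

(** Off 0, the inverse is a real power up to sign. *)
Lemma measurable_inv :
  measurable_fun setT (fun x : measurableTypeR R => x^-1 : R).
Proof.
rewrite (_ : (fun x => _) = (fun x : R => if 0 < x then x `^ (-1) else
    if x < 0 then - ((- x) `^ (-1)) else 0)); last first.
  apply/funext => x; case: ltrgt0P => [x0|x0|->]; last by rewrite invr0.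
    by rewrite powR_inv1// ltW.
  by rewrite powR_inv1 ?invrN ?opprK// oppr_ge0 ltW.
apply: measurable_fun_ifT => //; first exact: measurable_fun_ltr.
apply: measurable_fun_ifT => //; first exact: measurable_fun_ltr.
apply: measurableT_comp => //; exact: measurable_fun_powR.
Qed.

Lemma measurable_fun_inv d (T : measurableType d) (f : T -> R) :
  measurable_fun setT f -> measurable_fun setT (fun x => (f x)^-1).
Proof. exact: measurableT_comp measurable_inv. Qed.

Lemma measurable_fun_sqrt d (T : measurableType d) (f : T -> R) :
  measurable_fun setT f -> measurable_fun setT (fun x => Num.sqrt (f x)).
Proof.
apply: measurableT_comp; apply: continuous_measurable_fun.
exact: sqrt_continuous.
Qed.

Section fixed_dimension.
Variable n : nat.
Local Notation E := (eucl R n).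

Lemma measurable_fun_sqnorm d (T : measurableType d) (f g : T -> E) :
  measurable_fun setT f -> measurable_fun setT g ->
  measurable_fun setT (fun x => sqnorm n (f x - g x)).
Proof.
move=> mf mg; rewrite /sqnorm; apply: measurable_funD.
  apply: measurable_sum => i; apply: measurable_funX.
  rewrite (_ : (fun _ => _) = (fun x => (f x).1 0 i - (g x).1 0 i)); last first.
    by apply/funext => x; rewrite !mxE.
  by apply: measurable_funB; apply: measurableT_comp (measurable_rV_coord i) _;
    apply: measurableT_comp.
apply: measurable_funX.
rewrite (_ : (fun _ => _) = (fun x => (f x).2 - (g x).2 : R)) //.
by apply: measurable_funB; apply: measurableT_comp.
Qed.

Section composition.
Context d (T : measurableType d) (x y : T -> E) (t : T -> R).
Hypotheses (mx : measurable_fun setT x) (my : measurable_fun setT y).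
Hypothesis mt : measurable_fun setT t.

Let mx2 : measurable_fun setT (fun w => (x w).2 : R).
Proof. exact: measurableT_comp measurable_snd mx. Qed.

Let my2 : measurable_fun setT (fun w => (y w).2 : R).
Proof. exact: measurableT_comp measurable_snd my. Qed.

Lemma measurable_Gamma :
  measurable_fun setT (fun w => Gamma n (x w - y w) (t w)).
Proof.
apply: measurable_funM.
  by apply: measurable_fun_powR; exact: measurable_funM.
apply: measurableT_comp => //; apply: measurableT_comp => //.
apply: measurable_funM; first exact: measurable_fun_sqnorm.
by apply: measurable_fun_inv; exact: measurable_funM.
Qed.

Lemma measurable_G : measurable_fun setT (fun w => G n (x w) (y w) (t w)).
Proof.
apply: measurable_funM; first exact: measurable_Gamma.
apply: measurable_funB => //; apply: measurableT_comp => //.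
apply: measurableT_comp => //; apply: measurable_funM.
  exact: measurable_funM.
exact: measurable_fun_inv.
Qed.

Lemma measurable_K : measurable_fun setT (fun w => K n (x w) (y w) (t w)).
Proof.
apply: measurable_fun_ifT; first exact: measurable_fun_ltr.
  apply: measurable_funM; last exact: measurable_G.
  exact: measurable_fun_inv.
apply: measurable_funM; last exact: measurable_Gamma.
by apply: measurable_funM => //; exact: measurable_fun_inv.
Qed.

End composition.

Lemma measurable_Omega : measurable (Omega n : set E).
Proof.
rewrite (_ : Omega n = snd @^-1` `]0%R, +oo[); last first.
  by apply/seteqP; split => z /=; rewrite /Omega /= in_itv /= andbT.
by rewrite -[X in measurable X]setTI; apply: measurable_snd.
Qed.

Lemma measurable_Omegabar : measurable (Omegabar n : set E).
Proof.
rewrite (_ : Omegabar n = snd @^-1` `[0%R, +oo[); last first.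
  by apply/seteqP; split => z /=; rewrite /Omegabar /= in_itv /= andbT.
by rewrite -[X in measurable X]setTI; apply: measurable_snd.
Qed.

Lemma measurable_sqnorm_lt (d : measure_display) (T : measurableType d)
    (f g : T -> E) (r : T -> R) :
  measurable_fun setT f -> measurable_fun setT g -> measurable_fun setT r ->
  measurable [set w | Num.sqrt (sqnorm n (f w - g w)) < r w].
Proof.
move=> mf mg mr; rewrite -[X in measurable X]setTI.
apply: (@measurable_fun_ltr _ _ _ _
  (fun w => Num.sqrt (sqnorm n (f w - g w))) r _ _ measurableT [set true]) => //.
by apply: measurable_fun_sqrt; exact: measurable_fun_sqnorm.
Qed.

Lemma measurable_BOmega (z : E) (r : R) : measurable (BOmega n z r).
Proof.
apply: measurableI; last exact: measurable_Omegabar.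
exact: (@measurable_sqnorm_lt _ E id (cst z) (cst r)).
Qed.

End fixed_dimension.
End kernel_measurability.

(** * Gaussians on the line and on the half-line *)

Section gaussian.
Context {R : realType}.
Local Open Scope ring_scope.
Implicit Types a b c s t : R.

Definition gauss1 t a : R :=
  (4 * pi * t) `^ (- 2^-1) * expR (- (a ^+ 2 / (4 * t))).

Lemma gauss1_ge0 t a : 0 <= gauss1 t a.
Proof. by rewrite mulr_ge0 ?powR_ge0 ?expR_ge0. Qed.

Lemma gauss1N t a : gauss1 t (- a) = gauss1 t a.
Proof. by rewrite /gauss1 sqrrN. Qed.

Lemma measurable_gauss1 d (T : measurableType d) t (f : T -> R) :
  measurable_fun setT f -> measurable_fun setT (fun x => gauss1 t (f x)).
Proof.
move=> mf; apply: measurable_funM => //; apply: measurableT_comp => //.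
apply: measurableT_comp => //; apply: measurable_funM => //.
exact: measurable_funX.
Qed.

(** The Gaussian at time t is the normal density of variance 2 t, which gives
    its total mass. *)
Lemma gauss1_normal_pdf t a b : 0 < t ->
  gauss1 t (b - a) = normal_pdf a (Num.sqrt (2 * t)) b.
Proof.
move=> t0; have t20 : 0 < 2 * t by rewrite mulr_gt0.
rewrite normal_pdfE ?gt_eqF ?sqrtr_gt0// /normal_peak /normal_fun.
rewrite sqr_sqrtr ?ltW// /gauss1 powRN powR12_sqrt; last first.
  by rewrite mulr_ge0 ?ltW// mulr_gt0// pi_gt0.
congr ((Num.sqrt _)^-1 * expR _); first by rewrite -mulr_natr; ring.
by rewrite -mulNr -mulr_natr; congr (_ / _); ring.
Qed.

Lemma integral_gauss1 t a : 0 < t ->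
  (\int[@lebesgue_measure R]_b (gauss1 t (a - b))%:E = 1)%E.
Proof.
move=> t0; under eq_integral.
  by move=> b _; rewrite -opprB gauss1N gauss1_normal_pdf//; over.
exact: integral_normal_pdf.
Qed.

(** Completing the square in b: the product of the two bells is a bell in b,
    centred at the weighted mean of a and c, whose total mass is the value at
    a - c of the bell with added times. *)
Lemma gauss1_complete_square s t a b c : 0 < s -> 0 < t ->
  gauss1 t (a - b) * gauss1 s (b - c) = gauss1 (t + s) (a - c) *
    gauss1 (t * s / (t + s)) ((s * a + t * c) / (t + s) - b).
Proof.
move=> s0 t0; have ts0 : 0 < t + s by rewrite addr_gt0.
have pi0 : 0 < pi :> R by exact: pi_gt0.
rewrite /gauss1 mulrACA [RHS]mulrACA -!powRM -?expRD; last 4 first.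
- by apply: ltW; rewrite !mulr_gt0.
- by apply: ltW; rewrite !mulr_gt0// ?invr_gt0.
- by apply: ltW; rewrite !mulr_gt0.
- by apply: ltW; rewrite !mulr_gt0.
have p0 : (pi : R) != 0 by rewrite gt_eqF.
congr (_ `^ _ * expR _); field; rewrite ?p0 ?gt_eqF//.
Qed.

Lemma integral_gauss1_gauss1 s t a c : 0 < s -> 0 < t ->
  (\int[@lebesgue_measure R]_b (gauss1 t (a - b) * gauss1 s (b - c))%:E =
   (gauss1 (t + s)%R (a - c)%R)%:E)%E.
Proof.
move=> s0 t0; under eq_integral do rewrite gauss1_complete_square// EFinM.
rewrite ge0_integralZl_EFin ?gauss1_ge0//.
- by rewrite integral_gauss1 ?mule1// divr_gt0 ?mulr_gt0// addr_gt0.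
- by move=> b _; rewrite lee_fin gauss1_ge0.
- by apply/measurable_EFinP; apply: measurable_gauss1; exact: measurable_funB.
Qed.

(** Brings integrals over the half-line of products of reflected Gaussians
    back to integrals over the line. *)
Lemma integral_fold_half_line (h : R -> \bar R) :
  measurable_fun setT h -> (forall b, 0 <= h b)%E ->
  (\int[@lebesgue_measure R]_(b in `]0%R, +oo[) (h b + h (- b)%R) =
   \int[@lebesgue_measure R]_b h b)%E.
Proof.
move=> mh h0.
have mhN : measurable_fun setT (fun b => h (- b)) by exact: measurableT_comp.
rewrite ge0_integralD//; last 2 first.
- exact: measurable_funS mh.
- exact: measurable_funS mhN.
rewrite addeC (integral_itv_obnd_cbnd (f := fun b => h (- b))); last first.
  exact: measurable_funS mhN.
rewrite ge0_integration_by_substitution0//.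
have -> : (fun r => h (- - r)) = h by apply/funext => r; rewrite opprK.
rewrite -ge0_integral_setU//.
- congr (integral _ _ _); apply/seteqP; split => // b _ /=.
  by rewrite !in_itv /= andbT; case: leP; [left|right].
- by apply: measurable_funS mh.
- apply/disj_setPS => b /= []; rewrite !in_itv/= andbT => b0.
  by rewrite ltNge b0.
Qed.

(** The heat kernel of the half-line, by the method of images. *)
Definition dirichlet1 t a b := gauss1 t (a - b) - gauss1 t (a + b).

Lemma dirichlet1_ge0 t a b : 0 < t -> 0 <= a -> 0 <= b -> 0 <= dirichlet1 t a b.
Proof.
move=> t0 a0 b0; rewrite subr_ge0 ler_wpM2l ?powR_ge0// ler_expR lerN2.
rewrite ler_pM2r ?invr_gt0 ?mulr_gt0//.
have := mulr_ge0 a0 b0; lra.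
Qed.

(** Expanding the product of two reflected kernels gives four products of
    Gaussians; those of equal signs fold into the convolution over the line at
    a - c, those of opposite signs into the one at a + c. The latter are moved
    to the other side so that only nonnegative functions get integrated. *)
Lemma integral_dirichlet1 s t a c : 0 < s -> 0 < t -> 0 <= a -> 0 <= c ->
  (\int[@lebesgue_measure R]_(b in `]0%R, +oo[)
      (dirichlet1 t a b * dirichlet1 s b c)%:E =
   (dirichlet1 (t + s) a c)%:E)%E.
Proof.
move=> s0 t0 a0 c0; pose h e b := gauss1 t (a - e * b) * gauss1 s (b - c).
have mh e : measurable_fun setT (fun b => (h e b)%:E).
  apply/measurable_EFinP; apply: measurable_funM; apply: measurable_gauss1.
    by apply: measurable_funB => //; exact: measurable_funM.
  exact: measurable_funB.
have h0 e b : (0 <= (h e b)%:E)%E by rewrite lee_fin mulr_ge0 ?gauss1_ge0.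
have h1 : (\int[@lebesgue_measure R]_b (h 1%R b)%:E =
    (gauss1 (t + s) (a - c))%:E)%E.
  by under eq_integral do rewrite /h mul1r; exact: integral_gauss1_gauss1.
have hN1 : (\int[@lebesgue_measure R]_b (h (-1)%R b)%:E =
    (gauss1 (t + s)%R (a + c)%R)%:E)%E.
  under eq_integral do rewrite /h mulN1r -gauss1N opprD opprK.
  rewrite integral_gauss1_gauss1// -[in RHS]gauss1N opprD//.
have F1 := integral_fold_half_line (mh 1) (h0 1); rewrite h1 /= in F1.
have FN1 := integral_fold_half_line (mh (-1)) (h0 (-1)); rewrite hN1 /= in FN1.
have : (\int[@lebesgue_measure R]_(b in `]0%R, +oo[)
      ((dirichlet1 t a b * dirichlet1 s b c)%:E +
       ((h (-1)%R b)%:E + (h (-1)%R (- b)%R)%:E)) =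
   \int[@lebesgue_measure R]_(b in `]0%R, +oo[)
       ((h 1%R b)%:E + (h 1%R (- b)%R)%:E))%E.
  apply: eq_integral => b _; rewrite -!EFinD; congr EFin.
  rewrite /h /dirichlet1 !mul1r !mulN1r !opprK.
  rewrite -(gauss1N s (- b - c)) opprB opprK (addrC c b).
  ring.
rewrite integral_fold_half_line// h1 ge0_integralD//; last 4 first.
- move=> b; rewrite /= in_itv /= andbT => b0.
  by rewrite lee_fin mulr_ge0 ?dirichlet1_ge0// ltW.
- apply/measurable_EFinP; apply: measurable_funTS.
  by apply: measurable_funM; apply: measurable_funB; apply: measurable_gauss1;
    (exact: measurable_funB || exact: measurable_funD).
- by move=> b _; rewrite adde_ge0.
- apply: measurable_funTS; apply: emeasurable_funD; first exact: mh.
  by apply: (measurableT_comp (mh (-1))).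
by rewrite FN1 => IE; rewrite [in RHS]/dirichlet1 EFinB -IE addeK.
Qed.

End gaussian.

(** * The Dirichlet heat kernel of the half-space *)

Section heat_kernel.
Context {R : realType} (n : nat).
Local Notation E := (eucl R n.+1).
Local Open Scope ring_scope.
Implicit Types (s t : R) (x y z : E).

Lemma GammaE t x : 0 < t ->
  Gamma n.+1 x t = (\prod_i gauss1 t (x.1 0 i)) * gauss1 t x.2.
Proof.
move=> t0; rewrite /gauss1 big_split /= prodr_const card_ord -expR_sum.
rewrite mulrACA -exprSr -expRD /Gamma /sqnorm sumrN -mulr_suml.
rewrite -[X in _ = X * _]powR_mulrn ?powR_ge0// -powRrM.
congr (_ `^ _ * expR _); first by rewrite mulNr (mulrC n.+1%:R).
by rewrite -opprD -mulrDl.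
Qed.

Lemma Gamma_ge0 t x : 0 <= Gamma n.+1 x t.
Proof. by rewrite mulr_ge0 ?powR_ge0 ?expR_ge0. Qed.

(** The factor 1 - exp(-x_N y_N / t) replaces the Gaussian of the normal
    variable by its odd reflection, since (a - b)^2 + 4 a b = (a + b)^2. *)
Lemma GE t x y : 0 < t -> G n.+1 x y t =
  (\prod_i gauss1 t (x.1 0 i - y.1 0 i)) * dirichlet1 t x.2 y.2.
Proof.
move=> t0; rewrite /G GammaE// -mulrA; congr (_ * _).
  by apply: eq_bigr => i _; rewrite !mxE.
rewrite /dirichlet1 mulrBr mulr1; congr (_ - _).
rewrite /gauss1 -[LHS]mulrA -expRD; congr (_ * expR _) => /=.
by field; rewrite gt_eqF.
Qed.

Lemma Omegabar_Omega : Omega n.+1 `<=` (Omegabar n.+1 : set E).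
Proof. by move=> x; exact: ltW. Qed.

Lemma G_ge0 t x y : 0 < t -> Omegabar n.+1 x -> Omegabar n.+1 y ->
  0 <= G n.+1 x y t.
Proof.
move=> t0 x0 y0; rewrite GE// mulr_ge0 ?dirichlet1_ge0//.
by rewrite prodr_ge0// => i _; exact: gauss1_ge0.
Qed.

Lemma K_ge0 t x y : 0 < t -> Omegabar n.+1 x -> Omegabar n.+1 y ->
  0 <= K n.+1 x y t.
Proof.
move=> t0 x0 y0; rewrite /K; case: ifPn => y20.
  by rewrite mulr_ge0 ?G_ge0// invr_ge0 ltW.
by rewrite mulr_ge0 ?Gamma_ge0// divr_ge0// ltW.
Qed.

Lemma integral_Omega_mul (f : 'rV[R]_n -> R) (g : R -> R) :
  measurable_fun setT f -> measurable_fun setT (g : measurableTypeR R -> R) ->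
  (forall u, 0 <= f u) -> (forall b, 0 < b -> 0 <= g b) ->
  (\int[lebesgueE R n.+1]_(y in Omega n.+1) (f y.1 * g y.2)%:E =
   \int[lebesgue_rV R n]_u (f u)%:E *
   \int[@lebesgue_measure R]_(b in `]0%R, +oo[) (g b)%:E)%E.
Proof.
move=> mf mg f0 g0; rewrite integral_mkcond [X in _ = (_ * X)%E]integral_mkcond.
rewrite -(integral_prod_mul (sigma_finite_lebesgue_rV n) sigma_finite_lebesgue).
- apply: eq_integral => -[x b] _; rewrite /patch /=; have [b0|b0] := ltP 0 b.
    by rewrite !mem_set //= in_itv /= b0.
  rewrite !memNset ?mule0//= ?in_itv /= ?andbT /Omega /= ?leNgt.
    by apply/negP; rewrite -leNgt.
  by apply/negP; rewrite -leNgt.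
- exact/measurable_EFinP.
- apply/(measurable_restrictT _ _).1 => //; apply: measurable_funTS.
  exact/measurable_EFinP.
- by move=> x; rewrite lee_fin.
- move=> b; apply: erestrict_ge0 => {}b /=.
  by rewrite in_itv/= andbT lee_fin; exact: g0.
Qed.

Lemma integral_Gamma t x : 0 < t ->
  (\int[lebesgueE R n.+1]_y (Gamma n.+1 (x - y) t)%:E = 1)%E.
Proof.
move=> t0; pose f i b := gauss1 t (x.1 0 i - b).
have mf (i : 'I_n) : measurable_fun setT (f i : measurableTypeR R -> R).
  by apply: measurable_gauss1; exact: measurable_funB.
rewrite [LHS](_ : _ = \int[lebesgueE R n.+1]_y
    ((\prod_i f i (y.1 0%R i))%:E * (gauss1 t (x.2 - y.2))%:E))%E; last first.
  apply: eq_integral => y _; rewrite GammaE// EFinM; congr (_%:E * _)%E.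
  by apply: eq_bigr => i _; rewrite !mxE.
rewrite (integral_prod_mul (sigma_finite_lebesgue_rV n) sigma_finite_lebesgue
  (f := fun u => (\prod_i f i (u 0 i))%:E)
  (g := fun b => (gauss1 t (x.2 - b))%:E)).
- rewrite integral_gauss1// mule1 integral_rV_prod//; last first.
    by move=> i a; exact: gauss1_ge0.
  by rewrite big1// => i _; exact: integral_gauss1.
- by apply/measurable_EFinP; exact: measurable_prod_coord.
- by apply/measurable_EFinP; apply: measurable_gauss1; exact: measurable_funB.
- by move=> u; rewrite lee_fin prodr_ge0// => i _; exact: gauss1_ge0.
- by move=> b; rewrite lee_fin gauss1_ge0.
Qed.

Lemma integral_G_G s t x z : 0 < s -> 0 < t ->
  Omegabar n.+1 x -> Omegabar n.+1 z ->
  (\int[lebesgueE R n.+1]_(y in Omega n.+1) (G n.+1 x y t * G n.+1 y z s)%:E =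
   (G n.+1 x z (t + s))%:E)%E.
Proof.
move=> s0 t0 x0 z0.
pose f i b := gauss1 t (x.1 0 i - b) * gauss1 s (b - z.1 0 i).
pose g b := dirichlet1 t x.2 b * dirichlet1 s b z.2.
have mf (i : 'I_n) : measurable_fun setT (f i : measurableTypeR R -> R).
  by apply: measurable_funM; apply: measurable_gauss1; exact: measurable_funB.
have f0 i b : 0 <= f i b by rewrite mulr_ge0 ?gauss1_ge0.
rewrite [LHS](_ : _ = \int[lebesgueE R n.+1]_(y in Omega n.+1)
    ((\prod_i f i (y.1 0%R i)) * g y.2)%:E)%E; last first.
  by apply: eq_integral => y _; rewrite !GE// mulrACA -big_split.
rewrite (@integral_Omega_mul (fun u => \prod_i f i (u 0 i)) g).
- rewrite integral_rV_prod// integral_dirichlet1// GE ?addr_gt0// EFinM.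
  congr (_ * _)%E; rewrite -prodEFin; apply: eq_bigr => i _.
  exact: integral_gauss1_gauss1.
- exact: measurable_prod_coord.
- by apply: measurable_funM; apply: measurable_funB; apply: measurable_gauss1;
    (exact: measurable_funB || exact: measurable_funD).
- by move=> u; rewrite prodr_ge0.
- by move=> b b0; rewrite mulr_ge0// dirichlet1_ge0// ltW.
Qed.

(** At a boundary point K is the normal derivative of G, and G vanishes there;
    so K is the limit of its own interior values, which are difference
    quotients of G. *)
Lemma cvg_K_boundary t x z : 0 < t -> z.2 = 0 ->
  K n.+1 x (z.1, k.+1%:R^-1) t @[k --> \oo] --> K n.+1 x z t.
Proof.
move=> t0 z0; have [dG KE] := is_derive_G_boundary x t0 z0.
pose F h : R := h^-1 *: (G n.+1 x (z.1, h *: 1 + 0) t - G n.+1 x (z.1, 0) t).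
have {}dG : F h @[h --> 0^'] --> K n.+1 x z t by rewrite -KE; exact: dG.
rewrite [X in X @ \oo --> _](_ : _ =
    F \o (fun k : nat => k.+1%:R^-1)); last first.
  apply/funext => k; rewrite /F /= addr0 /K /= invr_gt0 ltr0n.
  rewrite [in RHS]/GRing.scale /= mulr1 (_ : G n.+1 x (z.1, 0) t = 0) ?subr0//.
  by rewrite /G /= mulr0 mul0r oppr0 expR0 subrr mulr0.
apply: cvg_comp dG => A [e /= e0 Ae]; near=> k; apply: Ae; last first.
  by rewrite invr_neq0// pnatr_eq0.
rewrite /= sub0r normrN ger0_norm//; near: k.
exact: (near_infty_natSinv_lt (PosNum e0)).
Unshelve. all: by end_near. Qed.

End heat_kernel.

(** * Estimates of the kernels *)

Section kernel_estimates.
Context {R : realType} (n : nat).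
Local Notation N := n.+1.
Local Notation E := (eucl R N).
Local Open Scope ring_scope.
Implicit Types (s t : R) (x y z : E).

Let integral_G_K_interior s t x z : 0 < s -> 0 < t ->
  Omegabar N x -> Omega N z ->
  (\int[lebesgueE R N]_(y in Omega N) (G N x y t * K N y z s)%:E =
   (K N x z (t + s))%:E)%E.
Proof.
move=> s0 t0 x0 z0.
rewrite [LHS](_ : _ = \int[lebesgueE R N]_(y in Omega N)
    ((z.2^-1)%:E * (G N x y t * G N y z s)%:E))%E; last first.
  by apply: eq_integral => y _; rewrite /K z0 -EFinM; congr EFin; ring.
rewrite ge0_integralZl_EFin.
- by rewrite integral_G_G// ?/K ?z0 ?EFinM//; exact: ltW.
- exact: measurable_Omega.
- move=> y y0; rewrite lee_fin mulr_ge0 ?G_ge0//; exact: ltW.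
- apply/measurable_EFinP; apply: measurable_funTS.
  by apply: measurable_funM; exact: measurable_G.
- by rewrite invr_ge0 ltW.
Qed.

(** In the interior this is Chapman-Kolmogorov divided by z_N, with equality.
    At the boundary, z is approached along the normal: Fatou's lemma keeps one
    inequality, which is all a supersolution requires. *)
Lemma integral_G_K_le s t x z : 0 < s -> 0 < t ->
  Omegabar N x -> Omegabar N z ->
  (\int[lebesgueE R N]_(y in Omega N) (G N x y t * K N y z s)%:E <=
   (K N x z (t + s))%:E)%E.
Proof.
move=> s0 t0 x0; rewrite /Omegabar /= le_eqVlt => /predU1P[z0|z0]; last first.
  by rewrite integral_G_K_interior.
pose zk k : E := (z.1, k.+1%:R^-1).
have zk0 k : Omega N (zk k) by rewrite /Omega /= invr_gt0.
rewrite [leLHS](_ : _ = \int[lebesgueE R N]_(y in Omega N)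
    (limn_einf (fun k => (G N x y t * K N y (zk k) s)%:E)))%E; last first.
  apply: eq_integral => y _; apply/esym/(@cvg_limn_einf_sup _ _ _ _).1.
  apply: cvg_EFin; first exact: nearW.
  by apply: cvgM; [exact: cvg_cst|exact: cvg_K_boundary].
apply: le_trans.
  apply: fatou; first exact: measurable_Omega.
    move=> k; apply/measurable_EFinP; apply: measurable_funTS.
    by apply: measurable_funM; [exact: measurable_G|exact: measurable_K].
  move=> k y y0; rewrite lee_fin mulr_ge0 ?G_ge0 ?K_ge0//;
    exact: Omegabar_Omega.
under eq_fun do rewrite integral_G_K_interior//.
rewrite (_ : limn_einf _ = (K N x z (t + s))%:E)//.
apply: (@cvg_limn_einf_sup _ _ _ _).1; apply: cvg_EFin; first exact: nearW.
by apply: cvg_K_boundary => //; exact: addr_gt0.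
Qed.

Lemma sqnorm_ge0 x : 0 <= sqnorm N x.
Proof. by rewrite addr_ge0 ?sumr_ge0 ?sqr_ge0// => i _; exact: sqr_ge0. Qed.

Lemma sqnormN x : sqnorm N (- x) = sqnorm N x.
Proof.
rewrite /sqnorm sqrrN; congr (_ + _).
by apply: eq_bigr => i _; rewrite mxE sqrrN.
Qed.

Lemma sqnormB x y : sqnorm N (x - y) = sqnorm N (y - x).
Proof. by rewrite -opprB sqnormN. Qed.

Lemma sqnormD_le x y : sqnorm N (x + y) <= 2 * sqnorm N x + 2 * sqnorm N y.
Proof.
have sq (a b : R) : (a + b) ^+ 2 <= 2 * a ^+ 2 + 2 * b ^+ 2.
  by have := sqr_ge0 (a - b); nra.
rewrite /sqnorm !mulrDr addrACA lerD//; last exact: sq.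
by rewrite !mulr_sumr -big_split /= ler_sum// => i _; rewrite mxE.
Qed.

(** Doubling the time trades half of the exponential decay for a constant. *)
Lemma Gamma_doubling t x : 0 < t ->
  Gamma N x t * expR (sqnorm N x / (8 * t)) =
  2 `^ (N%:R / 2) * Gamma N x (2 * t).
Proof.
move=> t0; rewrite /Gamma -[LHS]mulrA -expRD [RHS]mulrA; congr (_ * expR _).
  have -> : 4 * pi * (2 * t) = 2 * (4 * pi * t) by ring.
  have pit0 : 0 <= 4 * pi * t by rewrite !mulr_ge0 ?pi_ge0 ?ltW.
  rewrite [in RHS](powRM _ (ler0n R 2) pit0) [RHS]mulrA.
  rewrite -powRD ?subrr ?powRr0 ?mul1r//.
  by apply/implyP => _; rewrite pnatr_eq0.
by field; rewrite gt_eqF.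
Qed.

(** If y_N >= sqrt t, then 1/y_N <= 2/(y_N + sqrt t). Otherwise 1 - exp(-v) <=
    v gives K <= x_N/t Gamma, and x_N/sqrt t <= 1 + |x - y|/sqrt t is absorbed
    by half of the exponential decay of Gamma, at the price of doubling the
    time. *)
Lemma K_le t x y : 0 < t -> Omegabar N x -> Omegabar N y ->
  K N x y t <=
  6 * 2 `^ (N%:R / 2) * (Gamma N (x - y) (2 * t) * (y.2 + Num.sqrt t)^-1).
Proof.
move=> t0 x0 y0; set w := Num.sqrt t; have w0 : 0 < w by rewrite sqrtr_gt0.
have tE : t = w ^+ 2 by rewrite sqr_sqrtr// ltW.
have yw0 : 0 < y.2 + w by rewrite ltr_wpDl.
rewrite -mulrA [X in _ * X]mulrA -Gamma_doubling// mulrA ler_pdivlMr//.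
set r := sqnorm N (x - y); set g := Gamma N (x - y) t.
have g0 : 0 <= g by exact: Gamma_ge0.
have e0 : 1 + r / (8 * t) <= expR (r / (8 * t)) by exact: expR_ge1Dx.
set e := expR _ in e0 *.
(* q + y_N / w is x_N / w, and q^2 <= |x - y|^2 / t. *)
pose q : R := (x.2 - y.2) / w.
have qr : q ^+ 2 <= r / t.
  rewrite /q exprMn exprVn -tE ler_pM2r ?invr_gt0// /r /sqnorm.
  by rewrite lerDr sumr_ge0// => i _; exact: sqr_ge0.
have r0 : 0 <= r / t by rewrite divr_ge0 ?sqnorm_ge0// ltW.
have {}e0 : 1 + r / t / 8 <= e.
  by move: e0; rewrite invfM (mulrC 8^-1) mulrA.
have e1 : 1 <= e by apply: le_trans e0; lra.
have Kxy : K N x y t <= x.2 / t * g.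
  rewrite /K; case: ifPn => // y20.
  rewrite /G -/g ler_pdivrMl// mulrC.
  have := expR_ge1Dx (- (x.2 * y.2 / t)) => h.
  rewrite [leRHS](_ : _ = g * (x.2 * y.2 / t)); last by ring.
  by rewrite mulrC ler_wpM2l//; lra.
(* Far from the boundary: y_N + w <= 2 y_N. *)
have [yw|wy] := leP w y.2.
  have y20 : 0 < y.2 by apply: lt_le_trans yw.
  rewrite /K y20 /G -/g; set d := expR _.
  have d0 : 0 <= d by exact: expR_ge0.
  apply: (@le_trans _ _ (y.2^-1 * g * (2 * y.2))).
    apply: ler_pM => //; first by have := K_ge0 t0 x0 y0; rewrite /K y20.
    - exact: ltW.
    - rewrite ler_wpM2l ?invr_ge0 ?(ltW y20)// ler_piMr//; lra.
    - lra.
  rewrite [leLHS](_ : _ = 2 * g); last by field; rewrite gt_eqF.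
  nra.
(* Near the boundary: y_N + w <= 2 w. *)
apply: (@le_trans _ _ (x.2 / t * g * (2 * w))).
  apply: ler_pM => //; last by lra.
  - exact: K_ge0.
  - exact: ltW.
have -> : x.2 / t * g * (2 * w) = 2 * g * (x.2 / w).
  by rewrite [in LHS]tE; field; rewrite gt_eqF.
have -> : x.2 / w = q + y.2 / w by rewrite /q -mulrDl subrK.
have yw1 : y.2 / w <= 1 by rewrite ler_pdivrMr// mul1r ltW.
have : q + y.2 / w <= 3 * e by nra.
nra.
Qed.

(** A shift by at most sqrt t costs a constant once the time is doubled,
    because |x - z|^2 <= 2 |x - y|^2 + 2 |y - z|^2. *)
Lemma Gamma_shift_le t x y z : 0 < t -> sqnorm N (z - y) < t ->
  Gamma N (x - y) (2 * t) <=
  2 `^ (N%:R / 2) * expR 8^-1 * Gamma N (x - z) (4 * t).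
Proof.
move=> t0 zyt; have -> : 4 * t = 2 * (2 * t) by ring.
rewrite mulrAC -Gamma_doubling ?mulr_gt0// /Gamma -!mulrA.
rewrite ler_wpM2l ?powR_ge0// -!expRD ler_expR.
have : sqnorm N (x - z) <= 2 * sqnorm N (x - y) + 2 * sqnorm N (z - y).
  by have := sqnormD_le (x - y) (y - z); rewrite addrA subrK (sqnormB y z).
set a := sqnorm _ _; set b := sqnorm _ _ => /= ab.
have ab' : a <= 2 * b + 2 * t by apply: le_trans ab _; lra.
rewrite -subr_ge0 [X in 0 <= X](_ : _ = (2 * b + 2 * t - a) / (16 * t)).
  by rewrite divr_ge0 ?subr_ge0// mulr_ge0// ltW.
by field; rewrite gt_eqF.
Qed.

(** The cube with lowest corner y and side sqrt t / N lies in the ball around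
    y, its diameter being sqrt t / sqrt N and the cube being half-open, and in
    the half-space since y does. *)
Lemma lebesgue_BOmega_ge y t : Omegabar N y -> 0 < t ->
  (((Num.sqrt t / N%:R) ^+ N)%:E <= lebesgueE R N (BOmega N y (Num.sqrt t)))%E.
Proof.
move=> y0 t0; set w := Num.sqrt t; have w0 : 0 < w by rewrite sqrtr_gt0.
pose d : R := w / N%:R; have d0 : 0 < d by rewrite divr_gt0.
pose I (a : R) : set (measurableTypeR R) := `[a, a + d[%classic.
have mI a : measurable (I a) by exact: measurable_itv.
have lI a : lebesgue_measure (I a) = d%:E.
  by rewrite lebesgue_measure_itv /= lte_fin ltrDl d0 -EFinD addrC addKr.
pose A := [set u : 'rV[R]_n | forall i, I (y.1 0 i) (u 0 i)].
have mA : measurable A.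
  exact: (@measurable_rV_forall _ _ (fun i => I (y.1 0 i))).
have <- : lebesgueE R N (A `*` I y.2) = (d ^+ N)%:E.
  rewrite [LHS](product_measure1E (lebesgue_rV R n) lebesgue_measure)//.
  rewrite (lebesgue_rV_box (fun i => mI (y.1 0 i))).
  under eq_bigr do rewrite lI.
  rewrite [X in (_ * X)%E](lI y.2) prodEFin prodr_const card_ord.
  by rewrite -EFinM -exprSr.
apply: le_measure; rewrite ?inE.
- exact: measurableX.
- exact: measurable_BOmega.
move=> z [/= zA]; rewrite /I /= in_itv /= => /andP[z1 z2].
have sqd (a b : R) : b <= a -> a < b + d -> (a - b) ^+ 2 < d ^+ 2.
  by move=> ab abd; rewrite ltr_pXn2r ?nnegrE ?subr_ge0 ?(ltW d0)// ltrBlDl.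
split; last by apply: le_trans z1.
rewrite /= -[X in _ < X]ger0_norm ?(ltW w0)// -sqrtr_sqr ltr_sqrt ?exprn_gt0//.
apply: (@lt_le_trans _ _ (\sum_(i < n) d ^+ 2 + d ^+ 2)).
  rewrite /sqnorm ler_ltD//; last exact: sqd.
  apply: ler_sum => i _; rewrite !mxE; apply/ltW.
  by have := zA i; rewrite /I /= in_itv /= => /andP[za zb]; exact: sqd.
rewrite sumr_const card_ord -mulrSr -mulr_natr /d expr_div_n.
rewrite expr2 [X in _ / X]expr2 invfM -!mulrA mulVf ?mulr1 ?pnatr_eq0//.
by rewrite mulrA -expr2 ler_piMr ?sqr_ge0// invf_le1// ler1n.
Qed.

End kernel_estimates.

(** * The free evolution of the initial measure *)

Lemma measurable_EFin_restrict d (T : measurableType d) (R : realType)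
    (S : set T) (h : T -> R) :
  measurable S -> measurable_fun setT h ->
  measurable_fun setT ((EFin \o h) \_ S).
Proof.
move=> mS mh; apply/(measurable_restrictT _ _).1 => //.
by apply: measurable_funTS; exact/measurable_EFinP.
Qed.

Section potential.
Context {R : realType} (n : nat).
Local Notation N := n.+1.
Local Notation E := (eucl R N).
Implicit Types (s t : R) (x y z : E) (mu : {measure set E -> \bar R}).

Lemma radon_sigma_finite mu : radon N mu -> sigma_finite setT mu.
Proof.
move=> [_ mufin].
pose I (k : nat) : set R := `[(- k%:R)%R, k%:R%R]%classic.
pose A k := [set u : 'rV[R]_n | forall i, I k (u 0%R i)].
exists (fun k => A k `*` I k).
  apply/esym; rewrite -subTset => x _.
  pose r := (\sum_i `|x.1 0%R i| + `|x.2 : R|)%R.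
  exists (Num.truncn r).+1 => //.
  have rk : (r <= (Num.truncn r).+1%:R)%R by exact/ltW/truncnS_gt.
  split=> [i|]; rewrite /I /= in_itv /= -ler_norml (le_trans _ rk)// /r.
    rewrite (bigD1 i)//= -addrA lerDl addr_ge0//; exact: sumr_ge0.
  by rewrite lerDr sumr_ge0.
move=> k; split; last first.
  apply: (mufin (A k `*` I k)).
  apply: compact_setX; last exact: segment_compact.
  by apply: (@rV_compact R n (fun=> I k)) => i; exact: segment_compact.
apply: measurableX; last exact: measurable_itv.
by apply: (@measurable_rV_forall _ n (fun=> I k)) => i; exact: measurable_itv.
Qed.

Definition potential mu x t := \int[mu]_(y in Omegabar N) (K N x y t)%:E.

Definition local_mass mu s :=
  ereal_sup [set \int[mu]_(y in BOmega N z (Num.sqrt s))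
                   ((y.2 + Num.sqrt s)^-1)%:E | z in Omegabar N].

Lemma potential_ge0 mu x t : (0 < t)%R -> Omegabar N x -> 0 <= potential mu x t.
Proof. by move=> t0 x0; apply: integral_ge0 => y y0; rewrite lee_fin K_ge0. Qed.

Lemma local_mass_ge0 mu t : 0 <= local_mass mu t.
Proof.
apply: (@le_trans _ _ (\int[mu]_(y in BOmega N 0%R (Num.sqrt t))
   ((y.2 + Num.sqrt t)^-1)%:E)).
  by apply: integral_ge0 => y [_ y0]; rewrite lee_fin invr_ge0 addr_ge0.
by apply: ereal_sup_ubound; exists 0%R => //; exact: lexx.
Qed.

(** Balls grow with time while the weight 1/(y_N + sqrt s) decreases at most
    by the ratio of the radii. So an infinite mass at one time is infinite at
    all later times. *)
Lemma local_mass_le mu s t : (0 < s)%R -> (s <= t)%R ->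
  local_mass mu s <= (Num.sqrt t / Num.sqrt s)%:E * local_mass mu t.
Proof.
move=> s0 st; have t0 : (0 < t)%R by exact: lt_le_trans st.
set v := Num.sqrt s; set w := Num.sqrt t.
have v0 : (0 < v)%R by rewrite sqrtr_gt0.
have w0 : (0 < w)%R by rewrite sqrtr_gt0.
have vw : (v <= w)%R by exact: ler_wsqrtr.
apply: ge_ereal_sup => _ [z z0 <-].
have mq (r : R) : measurable_fun setT (fun y : E => ((y.2 + r)^-1)%:E).
  by apply/measurable_EFinP; apply: measurable_fun_inv; exact: measurable_funD.
have BB : BOmega N z v `<=` BOmega N z w.
  by move=> y [/= yv y0]; split => //=; exact: lt_le_trans vw.
apply: (@le_trans _ _ (\int[mu]_(y in BOmega N z v)
    ((w / v)%:E * ((y.2 + w)^-1)%:E))).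
  apply: ge0_le_integral_nonmeasurable => y [_ /= y0].
    by rewrite lee_fin invr_ge0 addr_ge0 ?(ltW v0).
  have yv0 : (0 < y.2 + v)%R by rewrite ltr_wpDl.
  have yw0 : (0 < y.2 + w)%R by rewrite ltr_wpDl.
  rewrite -EFinM lee_fin -(invf_div v w) -invfM.
  rewrite lef_pV2 ?posrE// ?mulr_gt0 ?invr_gt0//.
  rewrite mulrDr divfK ?gt_eqF// lerD2r ler_piMl//.
  by rewrite ler_pdivrMr// mul1r.
rewrite ge0_integralZl_EFin; last 4 first.
- exact: measurable_BOmega.
- by move=> y [_ /= y0]; rewrite lee_fin invr_ge0 addr_ge0 ?(ltW w0).
- exact: measurable_funTS.
- by rewrite divr_ge0 ?ltW.
apply: lee_wpmul2l; first by rewrite lee_fin divr_ge0 ?ltW.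
apply: (@le_trans _ _ (\int[mu]_(y in BOmega N z w) ((y.2 + w)^-1)%:E)).
  apply: ge0_subset_integral => //.
  - exact: measurable_BOmega.
  - exact: measurable_BOmega.
  - exact: measurable_funTS.
  - by move=> y [_ /= y0]; rewrite lee_fin invr_ge0 addr_ge0 ?(ltW w0).
by apply: ereal_sup_ubound; exists z.
Qed.

(** Replaces the value at y of a Gaussian by its average over a ball around y,
    a quantity in which integration over y produces masses of balls. *)
Lemma Gamma_average_le t x y : (0 < t)%R -> Omegabar N y ->
  (((Num.sqrt t / N%:R) ^+ N)%R * Gamma N (x - y)%R (2 * t)%R)%:E <=
  (2 `^ (N%:R / 2) * expR 8^-1)%:E *
  \int[lebesgueE R N]_(z in BOmega N y (Num.sqrt t))
    (Gamma N (x - z)%R (4 * t)%R)%:E.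
Proof.
move=> t0 y0; set w := Num.sqrt t; set B := BOmega N y w.
have mB : measurable B by exact: measurable_BOmega.
have mG : measurable_fun B (fun z => (Gamma N (x - z)%R (4 * t)%R)%:E).
  by apply/measurable_EFinP; apply: measurable_funTS; exact: measurable_Gamma.
apply: (@le_trans _ _ ((Gamma N (x - y)%R (2 * t)%R)%:E * lebesgueE R N B)).
  rewrite mulrC EFinM; apply: lee_wpmul2l; first by rewrite lee_fin Gamma_ge0.
  exact: lebesgue_BOmega_ge.
rewrite -integral_cst// -ge0_integralZl_EFin//; last first.
  by move=> z _; rewrite lee_fin Gamma_ge0.
apply: ge0_le_integral_nonmeasurable => z [/= zyw z0].
  by rewrite lee_fin Gamma_ge0.
rewrite -EFinM lee_fin Gamma_shift_le//.
by move: zyw; rewrite /w ltr_sqrt.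
Qed.

(** After [K_le] and [Gamma_average_le], the potential is bounded by a double
    integral over pairs (y, z) at distance less than sqrt t. The relation is
    symmetric, so in the other order the inner integral is over the ball
    around z; it is at most the local mass, and the remaining Gaussian has
    total mass 1. *)
Lemma potential_le : exists2 C : R, (0 < C)%R & forall mu t x,
  sigma_finite setT mu -> (0 < t)%R -> Omegabar N x ->
  potential mu x t <= (C * t `^ (- (N%:R / 2)))%:E * local_mass mu t.
Proof.
pose C1 : R := (6 * 2 `^ (N%:R / 2))%R.
pose C2 : R := (2 `^ (N%:R / 2) * expR 8^-1)%R.
have C10 : (0 < C1)%R by rewrite mulr_gt0// powR_gt0.
have C20 : (0 < C2)%R by rewrite mulr_gt0// ?powR_gt0// expR_gt0.
exists (C1 * C2 * N%:R ^+ N)%R.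
  by rewrite mulr_gt0 ?exprn_gt0// mulr_gt0.
move=> mu t x smu t0 x0; set w := Num.sqrt t.
have w0 : (0 < w)%R by rewrite sqrtr_gt0.
set v : R := ((w / N%:R) ^+ N)%R.
have v0 : (0 < v)%R by rewrite exprn_gt0// divr_gt0.
(* v is the volume of a cube contained in the ball of radius w. *)
have -> : (C1 * C2 * N%:R ^+ N * t `^ (- (N%:R / 2)) = C1 * C2 / v)%R.
  rewrite -mulrA; congr (_ * _)%R.
  rewrite /v expr_div_n invf_div powRN; congr (_ / _)%R.
  by rewrite /w -powR12_sqrt ?(ltW t0)// -powR_mulrn ?powR_ge0// -powRrM mulrC.
pose S : set (E * E) :=
  [set u | Omegabar N u.1] `&` [set u | Omegabar N u.2] `&`
  [set u | (Num.sqrt (sqnorm N (u.2 - u.1)) < w)%R].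
have mS : measurable S.
  apply: measurableI; last exact: measurable_sqnorm_lt.
  apply: measurableI.
    rewrite -[X in measurable X]setTI; apply: measurable_fst => //.
    exact: measurable_Omegabar.
  rewrite -[X in measurable X]setTI; apply: measurable_snd => //.
  exact: measurable_Omegabar.
pose h (u : E * E) : R := (Gamma N (x - u.2)%R (4 * t)%R * (u.1.2 + w)^-1)%R.
have mh : measurable_fun setT h.
  apply: measurable_funM; first exact: measurable_Gamma.
  apply: measurable_fun_inv; apply: measurable_funD => //.
  exact: measurableT_comp.
pose f := (EFin \o h) \_ S.
have f0 u : 0 <= f u.
  apply: erestrict_ge0 => {}u [[/= u0 _] _].
  by rewrite lee_fin mulr_ge0 ?Gamma_ge0// invr_ge0 addr_ge0 ?(ltW w0).
have mf : measurable_fun setT f.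
  exact: measurable_EFin_restrict.
pose F y := \int[lebesgueE R N]_z f (y, z).
have F0 y : 0 <= F y by apply: integral_ge0.
have mF : measurable_fun setT F.
  exact: (tonelli_measurable (sigma_finite_lebesgueE _)).
apply: (@le_trans _ _ (\int[mu]_(y in Omegabar N) ((C1 * C2 / v)%:E * F y))).
  apply: ge0_le_integral_nonmeasurable => y y0; first by rewrite lee_fin K_ge0.
  have yw0 : (0 < y.2 + w)%R by rewrite ltr_wpDl.
  have FE : F y = ((y.2 + w)^-1)%:E *
      \int[lebesgueE R N]_(z in BOmega N y w) (Gamma N (x - z)%R (4 * t)%R)%:E.
    rewrite -ge0_integralZl_EFin; last 4 first.
    - exact: measurable_BOmega.
    - by move=> z _; rewrite lee_fin Gamma_ge0.
    - apply/measurable_EFinP; apply: measurable_funTS.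
      exact: measurable_Gamma.
    - by rewrite invr_ge0 ltW.
    rewrite [RHS]integral_mkcond; apply: eq_integral => z _.
    rewrite /f /patch /=.
    have -> : ((y, z) \in S) = (z \in BOmega N y w).
      by apply/idP/idP; rewrite !inE /S /BOmega /=; tauto.
    by case: ifP => // _; rewrite -EFinM mulrC.
  have := K_le t0 x0 y0; rewrite -lee_fin => /le_trans; apply.
  have := Gamma_average_le x t0 y0; rewrite -/w -/v -/C2 => avg.
  rewrite FE -/C1.
  move: avg; set g := Gamma _ _ _; set q : R := ((y.2 + w)^-1)%R.
  set I := integral _ _ _.
  move=> avg; have q0 : (0 < q)%R by rewrite invr_gt0.
  rewrite [leLHS](_ : _ = (C1 * q / v)%R%:E * (v * g)%R%:E); last first.
    by rewrite -EFinM; congr EFin; field; rewrite gt_eqF.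
  rewrite [leRHS](_ : _ = (C1 * q / v)%R%:E * (C2%:E * I)); last first.
    by rewrite !muleA -!EFinM; congr (_%:E * _); ring.
  by apply: lee_wpmul2l => //; rewrite lee_fin divr_ge0 ?mulr_ge0 ?ltW.
rewrite ge0_integralZl_EFin//; last 3 first.
- exact: measurable_Omegabar.
- exact: measurable_funTS.
- by rewrite divr_ge0 ?(ltW v0)// mulr_ge0 ?ltW.
apply: lee_wpmul2l; first by rewrite lee_fin divr_ge0 ?(ltW v0)// mulr_ge0 ?ltW.
apply: (@le_trans _ _ (\int[mu]_y F y)).
  by apply: ge0_subset_integral => //; exact: measurable_Omegabar.
rewrite /F (tonelli_swap smu (sigma_finite_lebesgueE _))//.
apply: (@le_trans _ _ (\int[lebesgueE R N]_z
    ((Gamma N (x - z)%R (4 * t)%R)%:E * local_mass mu t))).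
  apply: ge0_le_integral_nonmeasurable => z _; first by apply: integral_ge0.
  have [z0|z0] := pselect (Omegabar N z); last first.
    rewrite integral0_eq ?mule_ge0 ?lee_fin ?Gamma_ge0 ?local_mass_ge0// => y _.
    by rewrite /f /patch memNset// => -[[]].
  rewrite [leLHS](_ : _ = (Gamma N (x - z)%R (4 * t)%R)%:E *
     \int[mu]_(y in BOmega N z w) ((y.2 + w)^-1)%:E).
    apply: lee_wpmul2l; first by rewrite lee_fin Gamma_ge0.
    by apply: ereal_sup_ubound; exists z.
  rewrite -ge0_integralZl_EFin ?Gamma_ge0//; last 3 first.
  - exact: measurable_BOmega.
  - by move=> y [_ y0]; rewrite lee_fin invr_ge0 addr_ge0 ?(ltW w0).
  - apply/measurable_EFinP; apply: measurable_funTS.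
    by apply: measurable_fun_inv; exact: measurable_funD.
  rewrite [RHS]integral_mkcond; apply: eq_integral => y _; rewrite /f /patch /=.
  have -> : ((y, z) \in S) = (y \in BOmega N z w).
    by apply/idP/idP; rewrite !inE /S /BOmega /= sqnormB; tauto.
  by case: ifP.
rewrite ge0_integralZr ?local_mass_ge0//.
- by rewrite integral_Gamma ?mul1e// mulr_gt0.
- by apply/measurable_EFinP; exact: measurable_Gamma.
- by move=> z _; rewrite lee_fin Gamma_ge0.
Qed.

Lemma potential_semigroup_le mu s t x : sigma_finite setT mu ->
  (0 < s)%R -> (0 < t)%R -> Omegabar N x ->
  \int[lebesgueE R N]_(y in Omega N) ((G N x y t)%:E * potential mu y s) <=
  potential mu x (t + s)%R.
Proof.
move=> smu s0 t0 x0.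
pose S : set (E * E) := Omega N `*` Omegabar N.
have mS : measurable S.
  by apply: measurableX; [exact: measurable_Omega|exact: measurable_Omegabar].
pose h (u : E * E) : R := (G N x u.1 t * K N u.1 u.2 s)%R.
have mh : measurable_fun setT h.
  by apply: measurable_funM; [exact: measurable_G|exact: measurable_K].
pose f := (EFin \o h) \_ S.
have f0 u : 0 <= f u.
  apply: erestrict_ge0 => {}u [/= /Omegabar_Omega u1 u2].
  by rewrite lee_fin mulr_ge0 ?G_ge0 ?K_ge0.
have mf : measurable_fun setT f.
  exact: measurable_EFin_restrict.
rewrite [leLHS](_ : _ = \int[lebesgueE R N]_y \int[mu]_z f (y, z)); last first.
  rewrite [LHS]integral_mkcond; apply: eq_integral => y _; rewrite [LHS]/patch.
  have [yO|yO] := boolP (y \in Omega N); last first.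
    rewrite integral0_eq// => z _; rewrite /f /patch memNset// => -[/= y0 _].
    by move/negP: yO; apply; rewrite inE.
  rewrite inE in yO; have yb := Omegabar_Omega yO.
  rewrite -ge0_integralZl_EFin ?G_ge0//; last 3 first.
  - exact: measurable_Omegabar.
  - by move=> z z0; rewrite lee_fin K_ge0.
  - by apply/measurable_EFinP; apply: measurable_funTS; exact: measurable_K.
  rewrite [LHS]integral_mkcond; apply: eq_integral => z _; rewrite /f /patch /=.
  have -> : ((y, z) \in S) = (z \in Omegabar N).
    by apply/idP/idP; rewrite !inE /S /=; tauto.
  by case: ifP => // _; rewrite -EFinM.
rewrite (tonelli_swap (sigma_finite_lebesgueE _) smu)//.
rewrite [leRHS]integral_mkcond; apply: ge0_le_integral_nonmeasurable => z _.
  by apply: integral_ge0.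
rewrite [leRHS]/patch; have [zO|zO] := boolP (z \in Omegabar N); last first.
  rewrite integral0_eq// => y _; rewrite /f /patch memNset// => -[/= _ z0].
  by move/negP: zO; apply; rewrite inE.
rewrite inE in zO; apply: le_trans (integral_G_K_le s0 t0 x0 zO).
rewrite [leRHS]integral_mkcond [leLHS](_ : _ = \int[lebesgueE R N]_y
   ((fun y => (G N x y t * K N y z s)%:E) \_ (Omega N)) y)//.
apply: eq_integral => y _; rewrite /f /patch /=.
suff -> : ((y, z) \in S) = (y \in Omega N) by [].
by apply/idP/idP; rewrite !inE /S /=; tauto.
Qed.

End potential.

(** * Monotone iteration *)

(** The Picard iterates of u = U + duhamel u from 0 are increasing, and a
    supersolution v bounds them; monotone convergence passes the integral
    equation to the limit, with no contraction argument. *)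
Section monotone_iteration.
Context d (T : measurableType d) (R : realType).
Variable m : {measure set T -> \bar R}.
Hypothesis sm : sigma_finite setT m.
Variables (p : R) (k : T * T -> R) (U : T -> \bar R) (v : T -> \bar R).
Hypothesis p0 : (0 < p)%R.
Hypothesis mk : measurable_fun setT k.
Hypothesis k0 : forall z, (0 <= k z)%R.
Hypothesis mU : measurable_fun setT U.
Hypothesis U0 : forall z, 0 <= U z.

Definition duhamel (u : T -> \bar R) z := \int[m]_w ((k (z, w))%:E * u w `^ p).

Hypothesis v0 : forall z, 0 <= v z.
Hypothesis v_super : forall z, U z + duhamel v z <= v z.

Let u_ i := iter i (fun u z => U z + duhamel u z) (cst 0).

Let integrand_ge0 u z w : 0 <= (k (z, w))%:E * u w `^ p.
Proof. by rewrite mule_ge0 ?lee_fin// poweR_ge0. Qed.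

Let duhamel_ge0 u z : 0 <= duhamel u z.
Proof. by apply: integral_ge0. Qed.

Let poweR_le (a b : \bar R) : 0 <= a -> a <= b -> a `^ p <= b `^ p.
Proof.
move=> a0 ab; apply: gt0_ler_poweR => //; first exact: ltW.
  by rewrite in_itv /= a0 leey.
by rewrite in_itv /= (le_trans a0 ab) leey.
Qed.

Let duhamel_le u1 u2 z : (forall w, 0 <= u1 w) -> (forall w, u1 w <= u2 w) ->
  duhamel u1 z <= duhamel u2 z.
Proof.
move=> u10 u12; apply: ge0_le_integral_nonmeasurable => w _ //.
by apply: lee_wpmul2l; rewrite ?lee_fin//; exact: poweR_le.
Qed.

Let u_ge0 i z : 0 <= u_ i z.
Proof. by case: i => [//|i]; rewrite /u_ /= adde_ge0. Qed.

Let measurable_integrand u z : measurable_fun setT u ->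
  measurable_fun setT (fun w => (k (z, w))%:E * u w `^ p).
Proof.
move=> mu; apply: emeasurable_funM.
  by apply/measurable_EFinP; apply: measurableT_comp mk _.
exact: measurableT_comp (measurable_poweR p) mu.
Qed.

Let measurable_duhamel u :
  measurable_fun setT u -> measurable_fun setT (duhamel u).
Proof.
move=> mu.
apply: (@tonelli_measurable _ _ _ _ _ m sm (fun z => (k z)%:E * u z.2 `^ p)).
  apply: emeasurable_funM; first exact/measurable_EFinP.
  by apply: measurableT_comp (measurable_poweR p) _; exact: measurableT_comp.
by case=> z w; exact: integrand_ge0.
Qed.

Let measurable_u i : measurable_fun setT (u_ i).
Proof.
elim: i => [|i ih]; first exact: measurable_cst.
by apply: emeasurable_funD => //; exact: measurable_duhamel.
Qed.

Let u_nd i z : u_ i z <= u_ i.+1 z.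
Proof.
elim: i z => [|i ih] z; first exact: u_ge0.
by apply: leeD2l; exact: duhamel_le.
Qed.

Let u_le i z : u_ i z <= v z.
Proof.
elim: i z => [|i ih] z; first exact: v0.
by apply: le_trans (v_super z); apply: leeD2l; exact: duhamel_le.
Qed.

Let u_nondecreasing z : nondecreasing_seq (u_ ^~ z).
Proof. by apply/nondecreasing_seqP => i; exact: u_nd. Qed.

Let lim_u z := limn (u_ ^~ z).

Let cvg_u z : u_ i z @[i --> \oo] --> lim_u z.
Proof. exact/cvgP/ereal_nondecreasing_cvgn. Qed.

Let u_le_lim i z : u_ i z <= lim_u z.
Proof.
by rewrite /lim_u (cvg_lim _ (ereal_nondecreasing_cvgn (@u_nondecreasing z)))//;
  apply: ereal_sup_ubound; exists i.
Qed.

(** The power commutes with increasing limits because its inverse is again a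
    monotone power. *)
Let cvg_poweR z : (u_ i z) `^ p @[i --> \oo] --> (lim_u z) `^ p.
Proof.
have nd : nondecreasing_seq (fun i => (u_ i z) `^ p).
  by move=> i j ij; apply: poweR_le => //; exact: u_nondecreasing.
have := ereal_nondecreasing_cvgn nd; set y := ereal_sup _.
suff -> : y = (lim_u z) `^ p by [].
have y0 : 0 <= y.
  apply: le_trans (poweR_ge0 (u_ 0%N z) p) _.
  by apply: ereal_sup_ubound; exists 0%N.
apply/eqP; rewrite eq_le; apply/andP; split.
  by apply: ge_ereal_sup => _ [i _ <-]; apply: poweR_le.
have pK : (p^-1 * p = 1)%R by rewrite mulVf ?gt_eqF.
have -> : y = (y `^ p^-1) `^ p by rewrite -poweRrM pK poweRe1.
apply: poweR_le; first exact: le_trans (u_le_lim 0%N z).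
rewrite /lim_u (cvg_lim _ (ereal_nondecreasing_cvgn (@u_nondecreasing z)))//.
apply: ge_ereal_sup => _ [i _ <-].
have {1}-> : u_ i z = (u_ i z `^ p) `^ p^-1.
  by rewrite -poweRrM mulrC pK poweRe1.
apply: gt0_ler_poweR.
- by rewrite invr_ge0 ltW.
- by rewrite in_itv /= poweR_ge0 leey.
- by rewrite in_itv /= y0 leey.
- by apply: ereal_sup_ubound; exists i.
Qed.

Lemma monotone_iteration : exists u : T -> \bar R,
  [/\ measurable_fun setT u, forall z, 0 <= u z, forall z, u z <= v z &
      forall z, u z = U z + duhamel u z].
Proof.
exists lim_u; split.
- by apply: emeasurable_fun_cvg measurable_u _ => z _; exact: cvg_u.
- by move=> z; apply: le_trans (u_le_lim 0%N z).
- by move=> z; apply: lime_le; [exact/cvgP/cvg_u|exact: nearW].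
move=> z; apply/cvg_lim => //; rewrite -(cvg_shiftS (u_ ^~ z)).
apply: cvgeD; [|exact: cvg_cst|].
  by rewrite ge0_adde_def// inE.
rewrite /duhamel [X in _ --> X](_ : _ =
    \int[m]_w limn (fun i => (k (z, w))%:E * u_ i w `^ p)); last first.
  apply: eq_integral => w _; apply/esym/cvg_lim => //.
  by apply: cvgeZl => //; exact: cvg_poweR.
apply: cvg_monotone_convergence => //.
- by move=> i; exact: measurable_integrand.
- move=> w _ i j ij; apply: lee_wpmul2l; rewrite ?lee_fin//.
  by apply: poweR_le => //; exact: u_nondecreasing.
Qed.

End monotone_iteration.

(** * Solutions of the problem *)

Section mild_solution.
Context {R : realType} (n : nat).
Local Notation N := n.+1.
Local Notation E := (eucl R N).
Local Notation leb := (@lebesgue_measure R).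
Local Notation Q := (E * measurableTypeR R)%type.
Variables (p : R) (mu : {measure set E -> \bar R}) (T : R).
Hypotheses (p1 : (1 < p)%R) (smu : sigma_finite setT mu).

Definition lebesgueQ : {measure set Q -> \bar R} :=
  (lebesgueE R N \x leb)%E.

Lemma sigma_finite_lebesgueQ : sigma_finite setT lebesgueQ.
Proof.
exact: sigma_finite_prod (sigma_finite_lebesgueE _) sigma_finite_lebesgue.
Qed.

Lemma measurable_QT : measurable (QT N T : set Q).
Proof.
by apply: measurableX; [exact: measurable_Omega|exact: measurable_itv].
Qed.

(** Up to the factor C^(p-1), a bound for the power p - 1 of the supremum over
    x of the potential at time s. *)
Definition mass_density (s : R) : \bar R :=
  (s `^ (- (N%:R * (p - 1) / 2)))%:E * local_mass mu s `^ (p - 1).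

Lemma mass_density_ge0 s : 0 <= mass_density s.
Proof. by rewrite mule_ge0 ?lee_fin ?powR_ge0// poweR_ge0. Qed.

(** Infinite local mass at a time t would propagate to the whole interval from
    t to T and make the integral diverge. *)
Lemma local_mass_lty :
  \int[leb]_(s in `]0%R, T[) mass_density s < +oo ->
  forall t, (0 < t < T)%R -> local_mass mu t < +oo.
Proof.
move=> fin t /andP[t0 tT]; rewrite ltey; apply/eqP => Mt.
suff : \int[leb]_(s in `]0%R, T[) mass_density s = +oo.
  by move=> foo; rewrite foo ltxx in fin.
apply/eqP; rewrite -leye_eq.
apply: (@le_trans _ _ (\int[leb]_(s in `]t, T[) cst +oo s)).
  rewrite integral_cst; last exact: measurable_itv.
  rewrite [X in _ * X](lebesgue_measure_itv `]t, T[) /= lte_fin tT gt0_mulye//.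
  by rewrite lte_fin subr_gt0.
apply: (@le_trans _ _ (\int[leb]_(s in `]t, T[) mass_density s)).
  apply: ge0_le_integral_nonmeasurable => s //=.
  rewrite in_itv /= => /andP[ts _].
  have s0 : (0 < s)%R by exact: lt_trans ts.
  have := local_mass_le mu t0 (ltW ts); rewrite Mt leye_eq => /eqP Ms.
  have {}Ms : local_mass mu s = +oo.
    have := local_mass_ge0 mu s; case: (local_mass mu s) Ms => //.
  rewrite /mass_density Ms poweRyr ?gt0_muley ?lte_fin ?powR_gt0//.
  by rewrite gt_eqF// subr_gt0.
apply: ge0_subset_integral_nonmeasurable => s; last first.
  by move=> _; exact: mass_density_ge0.
by rewrite /= !in_itv /= => /andP[ts ->]; rewrite (lt_trans t0).
Qed.

(** Extending by 0 outside the cylinder makes the function measurable and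
    nonnegative on the whole space, where Tonelli's theorem is applied. *)
Definition free_term : Q -> \bar R :=
  (fun z => potential mu z.1 z.2) \_ (QT N T).

Lemma free_term_ge0 z : 0 <= free_term z.
Proof.
apply: erestrict_ge0 => {}z [/= z1]; rewrite in_itv /= => /andP[z20 _].
exact: potential_ge0 (Omegabar_Omega z1).
Qed.

Lemma measurable_free_term : measurable_fun setT free_term.
Proof.
pose S : set (Q * E) := QT N T `*` Omegabar N.
have mS : measurable S.
  by apply: measurableX; [exact: measurable_QT|exact: measurable_Omegabar].
pose f : Q * E -> \bar R :=
  (EFin \o (fun u => K N u.1.1 u.2 u.1.2)) \_ S.
have mf : measurable_fun setT f.
  apply: measurable_EFin_restrict => //; apply: measurable_K => //.
    exact: measurableT_comp.
  by apply: (measurableT_comp measurable_snd).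
have f0 u : 0 <= f u.
  apply: erestrict_ge0 => {}u [[/= u1]].
  rewrite /= in_itv /= => /andP[u20 _] u0.
  by rewrite lee_fin K_ge0//; exact: Omegabar_Omega.
rewrite (_ : free_term = fun z => \int[mu]_y f (z, y)).
  exact: (@tonelli_measurable _ _ _ _ _ mu smu f).
apply/funext => z; rewrite /free_term {1}/patch.
have [zQ|zQ] := boolP (z \in QT N T).
  rewrite /potential integral_mkcond; apply: eq_integral => y _.
  rewrite /f /patch /=.
  suff -> : ((z, y) \in S) = (y \in Omegabar N) by [].
  by rewrite inE in zQ; apply/idP/idP; rewrite !inE /S /=; tauto.
rewrite integral0_eq// => y _; rewrite /f /patch memNset// => -[/= zQ' _].
by move/negP: zQ; apply; rewrite inE.
Qed.

Definition causal : set (Q * Q) :=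
  QT N T `*` QT N T `&` [set u | (u.2.2 < u.1.2 :> R)%R].

(** The restriction to past times turns the Duhamel term into the action of a
    single nonnegative kernel on the space-time product. *)
Definition causal_kernel (u : Q * Q) : R :=
  (G N u.1.1 u.2.1 (u.1.2 - u.2.2) * \1_causal u)%R.

Lemma measurable_causal_kernel : measurable_fun setT causal_kernel.
Proof.
have m12 : measurable_fun setT
    (fun u : Q * Q => u.1.2 : R).
  exact: (measurableT_comp measurable_snd measurable_fst).
have m22 : measurable_fun setT
    (fun u : Q * Q => u.2.2 : R).
  exact: (measurableT_comp measurable_snd measurable_snd).
apply: measurable_funM.
  apply: measurable_G; last exact: measurable_funB.
    exact: (measurableT_comp measurable_fst measurable_fst).
  exact: (measurableT_comp measurable_fst measurable_snd).
apply: measurable_indic; apply: measurableI.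
  by apply: measurableX; exact: measurable_QT.
rewrite -[X in measurable X]setTI.
exact: (@measurable_fun_ltr _ _ _ _ _ _ m22 m12 measurableT [set true]).
Qed.

Lemma causal_kernel_ge0 u : (0 <= causal_kernel u)%R.
Proof.
rewrite /causal_kernel indicE.
have [|_] := boolP (u \in causal); last by rewrite mulr0.
rewrite inE => -[[[/= u1 _] [/= u2 _]] /= u12]; rewrite mulr1 G_ge0 ?subr_gt0//;
  exact: Omegabar_Omega.
Qed.

Local Notation duhamelQ := (duhamel lebesgueQ p causal_kernel).

Lemma causal_kernel_slice (u : Q -> \bar R) z s :
  QT N T z -> (0 < s < (z.2 : R))%R ->
  \int[lebesgueE R N]_y ((causal_kernel (z, (y, s)))%:E * u (y, s) `^ p) =
  \int[lebesgueE R N]_(y in Omega N)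
    ((G N z.1 y (z.2 - s))%:E * u (y, s) `^ p).
Proof.
move=> [z1]; rewrite /= in_itv /= => /andP[z20 z2T] /andP[s0 sz].
rewrite [RHS]integral_mkcond; apply: eq_integral => y _; rewrite [RHS]/patch.
rewrite /causal_kernel indicE.
have -> : ((z, (y, s)) \in causal) = (y \in Omega N).
  apply/idP/idP; rewrite !inE /causal /=; first by case=> -[_ []].
  move=> yO; split => //; split; split => //=; rewrite in_itv /= ?z20//.
  by rewrite s0 (lt_trans sz).
by case: ifP => _; rewrite ?mulr1 ?mulr0 ?mul0e.
Qed.

Section duhamel_formula.
Variables (u : Q -> \bar R) (z : Q).
Hypotheses (mu_ : measurable_fun setT u) (zQ : QT N T z).

Let measurable_integrand : measurable_fun setT
  (fun w : Q => (causal_kernel (z, w))%:E * u w `^ p).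
Proof.
apply: emeasurable_funM; last exact: measurableT_comp (measurable_poweR p) mu_.
apply/measurable_EFinP; apply: measurableT_comp measurable_causal_kernel _.
exact: measurable_fun_pair.
Qed.

Let integrand_ge0 w : 0 <= (causal_kernel (z, w))%:E * u w `^ p.
Proof. by rewrite mule_ge0 ?poweR_ge0// lee_fin causal_kernel_ge0. Qed.

Lemma measurable_duhamel_slice :
  measurable_fun (`]0%R, (z.2 : R)[%classic : set (measurableTypeR R))
   (fun s => \int[lebesgueE R N]_(y in Omega N)
               ((G N z.1 y (z.2 - s))%:E * u (y, s) `^ p)).
Proof.
apply: (eq_measurable_fun (fun s => \int[lebesgueE R N]_y
    ((causal_kernel (z, (y, s)))%:E * u (y, s) `^ p))).
  by move=> s; rewrite inE /= in_itv /= => sz; exact: causal_kernel_slice.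
apply: measurable_funTS.
exact: (tonelli_measurable_snd (sigma_finite_lebesgueE N) measurable_integrand).
Qed.

Lemma duhamelE :
  duhamelQ u z = \int[leb]_(s in `]0%R, (z.2 : R)[)
    \int[lebesgueE R N]_(y in Omega N)
    ((G N z.1 y (z.2 - s))%:E * u (y, s) `^ p).
Proof.
rewrite /duhamel.
rewrite [LHS](@tonelli_prod _ _ _ _ _ (lebesgueE R N) leb
  (sigma_finite_lebesgueE _) sigma_finite_lebesgue
  (fun w => (causal_kernel (z, w))%:E * u w `^ p)); last 2 first.
- exact: measurable_integrand.
- exact: integrand_ge0.
rewrite [RHS]integral_mkcond; apply: eq_integral => s _; rewrite [RHS]/patch.
have [sz|sz] := boolP (s \in _).
  by move: sz; rewrite inE /= in_itv /=; exact: causal_kernel_slice.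
rewrite integral0_eq// => y _.
rewrite /causal_kernel indicE memNset ?mulr0 ?mul0e//.
move=> [[_ [_ /=]]]; rewrite in_itv /= => /andP[s0 _] sz'.
by move/negP: sz; apply; rewrite inE /= in_itv /= s0.
Qed.

End duhamel_formula.

Variables (C gamma : R).
Hypothesis C0 : (0 < C)%R.
Hypothesis small : (2 `^ p * C `^ (p - 1) * gamma <= 1)%R.
Hypothesis potential_bound : forall t x, (0 < t)%R -> Omegabar N x ->
  potential mu x t <= (C * t `^ (- (N%:R / 2)))%:E * local_mass mu t.
Hypothesis integral_bound :
  \int[leb]_(s in `]0%R, T[) mass_density s <= gamma%:E.

Lemma potential_lty t x :
  (0 < t < T)%R -> Omegabar N x -> potential mu x t < +oo.
Proof.
move=> tT x0; have /andP[t0 _] := tT.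
apply: le_lt_trans (potential_bound t0 x0) _.
apply: lte_mul_pinfty => //.
  by rewrite lee_fin mulr_ge0 ?powR_ge0// ltW.
by apply: local_mass_lty tT; exact: le_lt_trans integral_bound (ltry _).
Qed.

(** P^p = P^(p-1) P, and [potential_bound] is used on the first factor only:
    the second has to remain for the semigroup inequality. *)
Lemma potential_powR_le t x : (0 < t)%R -> Omegabar N x ->
  (2%:E * potential mu x t) `^ p <=
  (2 `^ p * C `^ (p - 1))%:E * mass_density t * potential mu x t.
Proof.
move=> t0 x0; have P0 := potential_ge0 mu t0 x0.
have q0 : (0 < p - 1)%R by rewrite subr_gt0.
have p0 : (0 < p)%R by exact: lt_trans p1.
rewrite poweRM// poweR_EFin EFinM -!muleA.
apply: lee_wpmul2l; first by rewrite lee_fin powR_ge0.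
have -> : potential mu x t `^ p =
    potential mu x t `^ (p - 1) * potential mu x t.
  rewrite -[X in _ = _ * X]poweRe1// -poweRD ?subrK//.
  by apply: add_neq0_poweRD_def; rewrite subrK gt_eqF.
rewrite !muleA; apply: lee_wpmul2r => //.
have Ct0 : (0 <= C * t `^ (- (N%:R / 2)))%R by rewrite mulr_ge0 ?powR_ge0// ltW.
have := potential_bound t0 x0 => /(gt0_ler_poweR (ltW q0)).
rewrite !in_itv /= !leey !andbT.
move=> /(_ P0); rewrite mule_ge0 ?local_mass_ge0// => /(_ isT)/le_trans; apply.
rewrite poweRM ?local_mass_ge0// poweR_EFin powRM ?powR_ge0 ?(ltW C0)//.
rewrite EFinM -powRrM.
by rewrite (_ : - (N%:R / 2) * (p - 1) = - (N%:R * (p - 1) / 2))%R//; ring.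
Qed.

(** The power bound extracts the local mass from the space integral, the
    semigroup inequality bounds what is left by the potential at (x, t)
    whatever the time s, and the time integral of the local mass is small. *)
Lemma duhamel_free_term_le z :
  free_term z + duhamelQ (fun w => 2%:E * free_term w) z <= 2%:E * free_term z.
Proof.
have mv : measurable_fun setT (fun w => 2%:E * free_term w).
  by apply: measurable_funeM; exact: measurable_free_term.
have [zQ|zQ] := pselect (QT N T z); last first.
  rewrite [X in _ + X](_ : _ = 0).
    by rewrite adde0 /free_term /patch memNset// mule0.
  apply: integral0_eq => w _.
  by rewrite /causal_kernel indicE memNset ?mulr0 ?mul0e// => -[[/= zQ' _] _].
rewrite mule_natl mule2n leeD2l// duhamelE//.
have [z1 /=] := zQ; rewrite in_itv /= => /andP[z20 z2T].
have z1b := Omegabar_Omega z1.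
have FE : free_term z = potential mu z.1 z.2.
  by rewrite /free_term /patch mem_set.
rewrite FE; set t : R := z.2; set x := z.1.
have Pfin : potential mu x t \is a fin_num.
  by rewrite ge0_fin_numE ?potential_ge0// potential_lty// z20.
have P0 : (0 <= fine (potential mu x t))%R by rewrite fine_ge0// potential_ge0.
pose c : R := (2 `^ p * C `^ (p - 1))%R.
have c0 : (0 <= c)%R by rewrite mulr_ge0 ?powR_ge0.
pose A s := \int[lebesgueE R N]_(y in Omega N)
  ((G N x y (t - s))%:E * (2%:E * free_term (y, s)) `^ p).
apply: (@le_trans _ _ ((c * fine (potential mu x t))%:E *
    \int[leb]_(s in `]0%R, t[) mass_density s)).
  apply: (@ge0_integral_le_scale_nonmeasurable _ _ R leb `]0%R, t[%classic
    A mass_density).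
  - exact: measurable_itv.
  - exact: (measurable_duhamel_slice mv zQ).
  - move=> s /=; rewrite in_itv /= => /andP[s0 st]; apply: integral_ge0 => y yO.
    rewrite mule_ge0 ?poweR_ge0// lee_fin G_ge0 ?subr_gt0//.
    exact: Omegabar_Omega.
  - by rewrite mulr_ge0.
  move=> s /=; rewrite in_itv /= => /andP[s0 st].
  have ts0 : (0 < t - s)%R by rewrite subr_gt0.
  apply: (@le_trans _ _ (\int[lebesgueE R N]_(y in Omega N)
     (c%:E * mass_density s * ((G N x y (t - s))%:E * free_term (y, s))))).
    apply: ge0_le_integral_nonmeasurable => y yO; have yb := Omegabar_Omega yO.
      by rewrite mule_ge0 ?poweR_ge0// lee_fin G_ge0.
    rewrite muleCA; apply: lee_wpmul2l; first by rewrite lee_fin G_ge0.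
    rewrite /free_term /patch mem_set; last first.
      by split => //=; rewrite in_itv /= s0 (lt_trans st).
    exact: potential_powR_le.
  rewrite ge0_integralZl; last 4 first.
  - exact: measurable_Omega.
  - apply: measurable_funTS; apply: emeasurable_funM.
      by apply/measurable_EFinP; exact: measurable_G.
    apply: measurableT_comp measurable_free_term _.
    exact: measurable_fun_pair.
  - move=> y yO; rewrite mule_ge0 ?free_term_ge0// lee_fin G_ge0//.
    exact: Omegabar_Omega.
  - by rewrite mule_ge0 ?mass_density_ge0// lee_fin.
  rewrite (EFinM c) fineK//.
  move: (mass_density s) (mass_density_ge0 s) => m m0.
  rewrite -!muleA; apply: lee_wpmul2l; first by rewrite lee_fin.
  rewrite [leRHS]muleC; apply: lee_wpmul2l => //.
  have := potential_semigroup_le smu s0 ts0 z1b; rewrite subrK; apply: le_trans.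
  apply: ge0_le_integral_nonmeasurable => y yO; have yb := Omegabar_Omega yO.
    by rewrite mule_ge0 ?free_term_ge0// lee_fin G_ge0.
  rewrite /free_term /patch mem_set//.
  by split => //=; rewrite in_itv /= s0 (lt_trans st).
apply: (@le_trans _ _ ((c * fine (potential mu x t))%:E * gamma%:E)).
  apply: lee_wpmul2l; first by rewrite lee_fin mulr_ge0.
  apply: le_trans integral_bound; apply: ge0_subset_integral_nonmeasurable => s.
    by rewrite /= !in_itv /= => /andP[-> /lt_trans->].
  by move=> _; exact: mass_density_ge0.
rewrite -EFinM -{2}(fineK Pfin) lee_fin mulrAC ler_piMl//.
Qed.

Lemma exists_solution : exists u : Q -> \bar R,
  is_solution N p mu T u.
Proof.
have p0 : (0 < p)%R by exact: lt_trans p1.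
have v0 w : 0 <= 2%:E * free_term w.
  by rewrite mule_ge0 ?free_term_ge0// lee_fin.
have [u [mu_ u0 uv uE]] := monotone_iteration sigma_finite_lebesgueQ p0
  measurable_causal_kernel causal_kernel_ge0 measurable_free_term free_term_ge0
  v0 duhamel_free_term_le.
exists u; split; [split|].
- exact: measurable_funTS.
- by move=> z _.
- apply: aeW => z zQ; apply: le_lt_trans (uv z) _.
  have [z1 /=] := zQ; rewrite in_itv /= => z2.
  apply: lte_mul_pinfty => //; rewrite /free_term /patch mem_set//.
  by apply: potential_lty => //; exact: Omegabar_Omega.
apply: aeW => z zQ; rewrite uE duhamelE//; congr (_ + _).
by rewrite /free_term /patch mem_set.
Qed.

End mild_solution.

Unset Implicit Arguments.

Theorem theorem5p1 (R : realType) (N : nat) (p : R) :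
  (1 <= N)%N -> (1 < p)%R ->
  exists gamma : R, (0 < gamma)%R /\
  forall mu : {measure set (eucl R N) -> \bar R}, radon N mu ->
  forall T : R, (0 < T)%R ->
  \int[@lebesgue_measure R]_(s in `]0%R, T[)
    ((s `^ (- (N%:R * (p - 1) / 2)))%:E *
     (ereal_sup [set \int[mu]_(y in BOmega N z (Num.sqrt s))
                       ((y.2 + Num.sqrt s)^-1)%:E | z in Omegabar N]) `^ (p - 1))
    <= gamma%:E ->
  exists u : eucl R N * measurableTypeR R -> \bar R, is_solution N p mu T u.
Proof.
case: N => // n _ p1.
have [C C0 bound] := @potential_le R n.
have c0 : (0 < 2 `^ p * C `^ (p - 1))%R by rewrite mulr_gt0 ?powR_gt0.
(* The Duhamel term of 2U is at most 2^p C^(p-1) gamma U, which is to be <= U. *)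
exists (2 `^ p * C `^ (p - 1))^-1%R; split; first by rewrite invr_gt0.
move=> mu /radon_sigma_finite smu T T0 hmu.
apply: (@exists_solution R n p mu T p1 smu C _ C0 _ _ hmu).
- by rewrite mulfV ?gt_eqF.
- by move=> t x t0 x0; exact: bound.
Qed.
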